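(* Suppose that the loss $\ell:\mathcal Y\times\mathcal Y\to\mathbb R$ satisfies, for all $\mathbf y,\mathbf y',\mathbf v,\mathbf v'\in\mathcal Y$, $|\ell(\mathbf y,\mathbf v)-\ell(\mathbf y',\mathbf v')|\le L_\ell(\|\mathbf y-\mathbf y'\|_2+\|\mathbf v-\mathbf v'\|_2)$, and that every $f\in\mathcal F$ satisfies $\|f(\rho,\mathbf x)-f(\rho',\mathbf x')\|_2\le L_f(W_1(\rho,\rho')+\|\mathbf x-\mathbf x'\|_2)$ for all $\rho,\rho'\in\mathcal P(\mathcal Z)$ and $\mathbf x,\mathbf x'\in\mathcal X$ (with the same constant $L_f$ for all $f\in\mathcal F$). Let $C_{\ell,f}:=L_\ell\big(L_f+\sqrt2\max\{1,L_f\}\big)$, let $M_\ell:=\sup_{\mathbf y,\mathbf y'\in\mathcal Y}|\ell(\mathbf y,\mathbf y')|<\infty$, and let $f^*\in\arg\min_{f\in\mathcal F}R_{\mathbb P}^{\ell}(f)$. Then: (i) (Masked ICL) If $\hat f\in\arg\min_{f\in\mathcal F}\widehat R_{T,N}^{\ell}(f)$, then $$\mathbb E[R_{\mathbb P}^{\ell}(\hat f)]-R_{\mathbb P}^{\ell}(f^* )\le 2C_{\ell,f}\,\mathbb E[\mathbb W_1(\mathbb P,\hat{\mathbb P}_T)]+2C_{\ell,f}\,\mathbb E[\mathbb W_1(\hat{\mathbb P}_T,\hat{\mathbb P}_{T,N})]+\frac{2L_\ell L_f}{TN}\sum_{t=1}^T\sum_{j=1}^N\mathbb E\big[W_1(\hat\rho_t^{\,N},\hat\rho_t^{\,(-j)})\big].$$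 (ii) (Autoregressive ICL) If $\bar f\in\arg\min_{f\in\mathcal F}\overline R_{T,N}^{\ell}(f)$, then $$\mathbb E[R_{\mathbb P}^{\ell}(\bar f)]-R_{\mathbb P}^{\ell}(f^* )\le 2C_{\ell,f}\,\mathbb E[\mathbb W_1(\mathbb P,\hat{\mathbb P}_T)]+2C_{\ell,f}\,\mathbb E[\mathbb W_1(\hat{\mathbb P}_T,\hat{\mathbb P}_{T,N})]+\frac{2L_\ell L_f}{T(N-1)}\sum_{t=1}^T\sum_{j=2}^N\mathbb E\big[W_1(\hat\rho_t^{\,N},\hat\rho_t^{(<j)})\big]+\frac{4M_\ell}{N}.$$
   Context: Setting. $\mathcal X\subseteq\mathbb R^{d_x}$ and $\mathcal Y\subseteq\mathbb R^{d_y}$ are compact, $\mathcal Z:=\mathcal X\times\mathcal Y\subseteq\mathbb R^{d_x+d_y}$, all with the Euclidean norm. $\mathcal P(\mathcal Z)$ is the space of Borel probability measures on $\mathcal Z$ with the weak topology; a task is an element $\rho\in\mathcal P(\mathcal Z)$, and $\mathbb P\in\mathcal P(\mathcal P(\mathcal Z))$ is a meta-distribution (a Borel probability measure on $\mathcal P(\mathcal Z)$). Distances. $W_1(\rho,\rho'):=\inf_{\gamma\in\Gamma(\rho,\rho')}\int\|\mathbf z-\mathbf z'\|_2\,d\gamma(\mathbf z,\mathbf z')$ for $\rho,\rho'\in\mathcal P(\mathcal Z)$; for meta-distributions $\mathbb P,\mathbb Q$, the lifted distance is $\mathbb W_1(\mathbb P,\mathbb Q):=\inf_{\pi\in\Gamma(\mathbb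 P,\mathbb Q)}\int W_1(\rho,\rho')\,d\pi(\rho,\rho')$. $\Gamma(\cdot,\cdot)$ denotes the set of couplings. Predictors and risk. $\mathcal F$ is a class of measurable maps $f:\mathcal P(\mathcal Z)\times\mathcal X\to\mathcal Y$, and $R_{\mathbb P}^{\ell}(f):=\int_{\mathcal P(\mathcal Z)}\int_{\mathcal Z}\ell(\mathbf y,f(\rho,\mathbf x))\,d\rho(\mathbf x,\mathbf y)\,d\mathbb P(\rho)$. Training data. $T\ge1$, $N\ge2$; $(\rho_t)_{t=1}^T$ are i.i.d. from $\mathbb P$ and, for each $t$, given $\rho_t$, $\mathbf z_{t,j}=(\mathbf x_{t,j},\mathbf y_{t,j})$, $j=1,\dots,N$, are i.i.d. from $\rho_t$. Empirical measures: $\hat\rho_t^{\,N}:=\frac1N\sum_{j=1}^N\delta_{\mathbf z_{t,j}}$; $\hat\rho_t^{\,(-j)}:=\frac1{N-1}\sum_{j'\ne j}\delta_{\mathbf z_{t,j'}}$; $\hat\rho_t^{(<j)}:=\frac1{j-1}\sum_{j'=1}^{j-1}\delta_{\mathbf z_{t,j'}}$ for $j\ge2$; $\hat{\mathbb P}_T:=\frac1T\sum_{t=1}^T\delta_{\rho_t}$; $\hat{\mathbb P}_{T,N}:=\frac1T\sum_{t=1}^T\delta_{\hat\rho_t^{\,N}}$. Objectives. Masked: $\widehat R_{T,N}^{\ell}(f):=\frac1{TN}\sum_{t=1}^T\sum_{j=1}^N\ell(\mathbf y_{t,j},f(\hat\rho_t^{\,(-j)},\mathbf x_{t,j}))$.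 Autoregressive: $\overline R_{T,N}^{\ell}(f):=\frac1{T(N-1)}\sum_{t=1}^T\sum_{j=2}^N\ell(\mathbf y_{t,j},f(\hat\rho_t^{(<j)},\mathbf x_{t,j}))$. Expectations $\mathbb E$ are over the training data (tasks and samples). *)

(* Defs.v *)
From HB Require Import structures.
From mathcomp Require Import all_boot all_order all_algebra.
From mathcomp Require Import all_classical all_reals all_analysis.

Set Implicit Arguments.
Unset Strict Implicit.
Unset Printing Implicit Defensive.

Import Order.TTheory GRing.Theory Num.Theory.
Import numFieldTopology.Exports numFieldNormedType.Exports.

Local Open Scope classical_set_scope.
Local Open Scope ring_scope.

Section EuclideanSpace.
Variable R : realType.

(* The library norm on 'rV[R]_d is the sup norm. *)
Definition enorm d (v : 'rV[R]_d) : R := Num.sqrt (\sum_(i < d) v ord0 i ^+ 2).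

(* Measurable types are pointed in the library, so nonemptiness is bundled. This
   loses nothing: a set carrying a probability measure is nonempty. *)
Record compactSet d := CompactSet {
  carrier :> set 'rV[R]_d;
  carrier_compact : compact carrier;
  carrier_nonempty : carrier !=set0 }.

Definition points d (K : compactSet d) : Type := set_type (carrier K).

Definition default_point d (K : compactSet d) : points K :=
  let: exist x Kx := cid (carrier_nonempty K) in SigSub (mem_set Kx).

HB.instance Definition _ d (K : compactSet d) :=
  PseudoMetric.copy (points K) (set_type (carrier K)).
HB.instance Definition _ d (K : compactSet d) :=
  isPointed.Build (points K) (default_point K).

Definition edist d (K : compactSet d) (x y : points K) : R :=
  enorm (set_val x - set_val y).

Definition samples dx dy (X : compactSet dx) (Y : compactSet dy) : Type :=
  (points X * points Y)%type.

HB.instance Definition _ dx dy (X : compactSet dx) (Y : compactSet dy) :=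
  PseudoMetric.copy (samples X Y) (points X * points Y)%type.
HB.instance Definition _ dx dy (X : compactSet dx) (Y : compactSet dy) :=
  Pointed.copy (samples X Y) (points X * points Y)%type.

(* The embedding of X * Y in R^(dx + dy) by concatenation of coordinates. *)
Definition concat dx dy (X : compactSet dx) (Y : compactSet dy)
    (z : samples X Y) : 'rV[R]_(dx + dy) :=
  row_mx (set_val z.1) (set_val z.2).

Definition sdist dx dy (X : compactSet dx) (Y : compactSet dy)
    (z z' : samples X Y) : R :=
  enorm (concat z - concat z').

End EuclideanSpace.

Coercion points : compactSet >-> Sortclass.

Definition borel (T : ptopologicalType) := g_sigma_algebraType (@open T).
HB.instance Definition _ (T : ptopologicalType) := Measurable.on (borel T).

Section SpaceOfProbabilities.
Variables (R : realType) (T : ptopologicalType).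

Definition bounded_continuous : Type :=
  {phi : T -> R | continuous phi /\ exists M, forall x, `|phi x| <= M}.

Definition integrate (mu : probability (borel T) R) :
    {ptws bounded_continuous -> R} :=
  fun phi => \int[mu]_x sval phi x.

(* The weak topology: the coarsest one for which mu |-> \int phi d mu is
   continuous for every bounded continuous phi. *)
Definition Prob : Type := initial_topology integrate.

HB.instance Definition _ := Topological.on Prob.
HB.instance Definition _ := Pointed.on Prob.

End SpaceOfProbabilities.

Section Transport.
Local Open Scope ereal_scope.
Variables (R : realType) (T : ptopologicalType).

Definition couplings (mu nu : Prob R T) : set (probability (borel T * borel T)%type R) :=
  [set g | forall A : set (borel T), measurable A ->
     g (A `*` setT) = mu A /\ g (setT `*` A) = nu A].

Definition transport (c : T -> T -> \bar R) (mu nu : Prob R T) : \bar R :=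
  ereal_inf [set \int[g]_u c u.1 u.2 | g in couplings mu nu].

End Transport.

Section Empirical.
Local Open Scope ereal_scope.
Context (R : realType) d (T : measurableType d) (n : nat) (s : 'I_n.+1 -> T).

Definition empirical (A : set T) : \bar R :=
  (n.+1%:R^-1)%:E * \sum_(i < n.+1) \d_(s i) A.

Let dirac_seq (i : nat) : {measure set T -> \bar R} := \d_(s (inord i)).
Let c : {nonneg R} := (n.+1%:R^-1%:nng)%R.

Let empiricalE : empirical = mscale c (msum dirac_seq n.+1).
Proof.
apply/funext => A; rewrite /empirical /mscale /msum/=; congr (_ * _).
by apply: eq_bigr => i _; rewrite /dirac_seq inord_val.
Qed.

Let empirical0 : empirical set0 = 0.
Proof. by rewrite empiricalE measure0. Qed.

Let empirical_ge0 A : 0 <= empirical A.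
Proof. by rewrite empiricalE measure_ge0. Qed.

Let empirical_sigma_additive : semi_sigma_additive empirical.
Proof. by rewrite empiricalE; exact: measure_semi_sigma_additive. Qed.

HB.instance Definition _ := isMeasure.Build _ _ _ empirical
  empirical0 empirical_ge0 empirical_sigma_additive.

Let empiricalT : empirical setT = 1.
Proof.
rewrite /empirical; under eq_bigr do rewrite diracT.
by rewrite sumEFin -EFinM sumr_const card_ord mulVf// pnatr_eq0.
Qed.

HB.instance Definition _ :=
  Measure_isProbability.Build _ _ _ empirical empiricalT.

End Empirical.

Definition empirical_prob (R : realType) (T : ptopologicalType) n
    (s : 'I_n.+1 -> T) : Prob R T :=
  empirical R (s : 'I_n.+1 -> borel T) : probability (borel T) R.

Section InContextLearning.
Local Open Scope ereal_scope.
Variables (R : realType) (dx dy : nat) (X : compactSet R dx) (Y : compactSet R dy).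

Local Notation Z := (samples X Y).

Definition task : ptopologicalType := Prob R Z.
Definition meta : Type := Prob R task.

Definition W1 (rho rho' : task) : \bar R :=
  transport (fun z z' => (sdist z z')%:E) rho rho'.

Definition metaW1 (PP QQ : meta) : \bar R := transport W1 PP QQ.

Definition predictor : Type :=
  {mfun (borel task * borel (points X))%type
         >-> borel (points Y)}.

Definition risk (l : Y -> Y -> R) (PP : meta) (f : predictor) : \bar R :=
  \int[PP]_rho \int[rho]_z (l z.2 (f (rho, z.1)))%:E.

Definition argmin_on (U : Type) (C : U -> \bar R) (F : set U) : set U :=
  [set f | F f /\ forall g, F g -> C f <= C g].

Definition loss_lipschitz (Ll : R) (l : Y -> Y -> R) : Prop :=
  forall y y' v v' : Y,
    (`|l y v - l y' v'| <= Ll * (edist y y' + edist v v'))%R.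

Definition predictor_lipschitz (Lf : R) (f : predictor) : Prop :=
  forall (rho rho' : task) (x x' : X),
    (edist (f (rho, x)) (f (rho', x')))%:E
      <= Lf%:E * (W1 rho rho' + (edist x x')%:E).

Definition Clf (Ll Lf : R) : R := (Ll * (Lf + Num.sqrt 2 * Num.max 1 Lf))%R.

(* Finite as soon as l is Lipschitz, the carrier of Y being compact. *)
Definition loss_bound (l : Y -> Y -> R) : \bar R :=
  ereal_sup [set `|l p.1 p.2|%:E | p in [set: Y * Y]].

(* There are m.+1 >= 1 tasks and n.+2 >= 2 samples per task. *)
Variable n : nat.

Definition emp_all (z : 'I_n.+2 -> Z) : task := empirical_prob R z.

Definition emp_others (z : 'I_n.+2 -> Z) (j : 'I_n.+2) : task :=
  empirical_prob R (fun i : 'I_n.+1 => z (lift j i)).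

(* The empirical measure of the samples 0, ..., k, i.e. of those strictly before
   the sample k + 1 = lift ord0 k (indices start at 0). *)
Definition emp_before (z : 'I_n.+2 -> Z) (k : 'I_n.+1) : task :=
  empirical_prob R (fun i : 'I_k.+1 => z (widen_ord (leqW (ltn_ord k)) i)).

Variable m : nat.

Definition masked_risk (l : Y -> Y -> R) (z : 'I_m.+1 -> 'I_n.+2 -> Z)
    (f : predictor) : R :=
  ((m.+1%:R * n.+2%:R)^-1 * \sum_(t < m.+1) \sum_(j < n.+2)
     l (z t j).2 (f (emp_others (z t) j, (z t j).1)))%R.

Definition autoregressive_risk (l : Y -> Y -> R) (z : 'I_m.+1 -> 'I_n.+2 -> Z)
    (f : predictor) : R :=
  ((m.+1%:R * n.+1%:R)^-1 * \sum_(t < m.+1) \sum_(k < n.+1)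
     l (z t (lift ord0 k)).2
       (f (emp_before (z t) k, (z t (lift ord0 k)).1)))%R.

(* rho t is the random task t and z t j its j-th sample; the second clause of
   training_data says that, given rho t, the z t j are i.i.d. from rho t. *)
Section TrainingData.
Context d (Omega : measurableType d) (Pr : probability Omega R) (PP : meta)
  (rho : 'I_m.+1 -> {RV Pr >-> borel task})
  (z : 'I_m.+1 -> 'I_n.+2 -> {RV Pr >-> borel Z}).

Definition block_event t (A : set (borel task)) (B : 'I_n.+2 -> set (borel Z)) :
    set Omega :=
  rho t @^-1` A `&` \bigcap_j (z t j @^-1` B j).

(* The rectangles (block_event) form a pi-system that contains the whole space
   and generates the sigma-algebra of (rho t, z t 0, z t 1, ...), so the product
   rule over all t is mutual independence of these blocks. *)
Definition training_data : Prop :=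
  [/\ forall t (A : set (borel task)), measurable A ->
        distribution Pr (rho t) A = PP A,
      forall t A B, measurable A -> (forall j, measurable (B j)) ->
        Pr (block_event t A B) =
          \int[Pr]_(w in rho t @^-1` A) \big[*%E/1]_(j < n.+2) rho t w (B j) &
      forall (A : 'I_m.+1 -> set (borel task))
             (B : 'I_m.+1 -> 'I_n.+2 -> set (borel Z)),
        (forall t, measurable (A t)) -> (forall t j, measurable (B t j)) ->
        Pr (\bigcap_t block_event t (A t) (B t)) =
          \big[*%E/1]_(t < m.+1) Pr (block_event t (A t) (B t))].

End TrainingData.

End InContextLearning.

(* Main.v *)
From HB Require Import structures.
From mathcomp Require Import all_boot all_order all_algebra.
From mathcomp Require Import all_classical all_reals all_analysis.
From mathcomp Require Import measurable_realfun lebesgue_measure.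
From mathcomp Require Import ring lra.
(* Required last, so that [edist] is the Euclidean distance of [Defs] and not
   the extended distance of the library. *)
Require Import Defs.

(* The bound holds pointwise in the training data: the excess risk of an
   empirical minimiser is at most twice the uniform deviation of the objectives
   over the class, and along a coupling the integrand (task risk, or loss at a
   sample) is Lipschitz for the transport cost, so that the deviations are
   controlled by the two lifted distances and by the distances between the full
   and the partial contexts.  The autoregressive objective omits one sample out
   of N per task, which costs 2 M / N on each of the two sides.

   What is left is to integrate this bound, although neither the distances nor
   the learned predictor need to depend measurably on the data.  The integral of
   a nonnegative function is a supremum over the simple functions below it: it
   is monotone, but not subadditive, without measurability.  So each term is
   first replaced by a measurable one below it, the maximum of a deviation over
   a finite net of predictors.  Such a net exists because the tasks are totally
   bounded for W_1: two tasks that give almost the same mass to each cell of a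
   fine partition have a coupling that leaves the diagonal cells with small
   probability. *)

Set Implicit Arguments.
Unset Strict Implicit.
Unset Printing Implicit Defensive.

Import Order.TTheory GRing.Theory Num.Theory.
Import numFieldTopology.Exports numFieldNormedType.Exports.

Local Open Scope classical_set_scope.
Local Open Scope ring_scope.

(** * Integrals without measurability *)

Section LowerIntegral.
Import HBNNSimple.
Local Open Scope ereal_scope.
Context d (T : measurableType d) (R : realType).
Implicit Types mu : {measure set T -> \bar R}.

(** Holds for arbitrary functions: the supremum over simple functions below grows with a nonnegative
    function, and in general the positive part grows while the negative part shrinks. *)
Lemma integral_mono mu (f g : T -> \bar R) :
  (forall x, f x <= g x) -> \int[mu]_x f x <= \int[mu]_x g x.
Proof.
have mono0 (u v : T -> \bar R) : (forall x, 0 <= u x) ->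
    (forall x, u x <= v x) -> \int[mu]_x u x <= \int[mu]_x v x.
  move=> u0 uv; have v0 x : 0 <= v x by exact: le_trans (uv x).
  rewrite !ge0_integralTE//; apply: ereal_sup_le => _ [h /= hu <-].
  by exists h => // x; exact: le_trans (hu x) (uv x).
move=> fg; rewrite integralE [leRHS]integralE; apply: leeB; apply: mono0 => // x.
  by apply: (@funepos_le _ _ setT); rewrite ?inE// => y _; exact: fg.
by apply: (@funeneg_le _ _ setT); rewrite ?inE// => y _; exact: fg.
Qed.

Variable P : probability T R.

Lemma bounded_integrable (f : T -> R) (M : R) : measurable_fun setT f ->
  (forall x, (`|f x| <= M)%R) -> P.-integrable setT (EFin \o f).
Proof.
move=> mf fM; apply: measurable_bounded_integrable => //.
  by rewrite [X in X < _](_ : _ = 1) ?ltry//; exact: probability_setT.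
by exists M; split; rewrite ?num_real // => N MN x _; exact: le_trans (fM x) (ltW MN).
Qed.

Lemma integral_cst_prob (k : R) : \int[P]_x k%:E = k%:E.
Proof. rewrite integral_cst// [X in _ * X](_ : _ = 1) ?mule1//; exact: probability_setT. Qed.

(** As h may fail to be measurable, its integral cannot be split off directly. The measurable
    function [g'], the positive part of (g - k) / c, lies below h and still satisfies g <= k + c g',
    so linearity is applied to [g']. For c = 0 the bound is g <= k, since 0 times infinity is 0. *)
Lemma integral_le_affine (g : T -> R) (M k c : R) (h : T -> \bar R) :
  measurable_fun setT g -> (forall x, (`|g x| <= M)%R) ->
  (0 <= c)%R -> (forall x, 0 <= h x) ->
  (forall x, (g x)%:E <= k%:E + c%:E * h x) ->
  \int[P]_x (g x)%:E <= k%:E + c%:E * \int[P]_x h x.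
Proof.
move=> mg gM; rewrite le_eqVlt => /predU1P[<-|c0] h0 gh.
  rewrite mul0e adde0 -[leRHS]integral_cst_prob; apply: integral_mono => x.
  by have := gh x; rewrite mul0e adde0.
pose g' x := Num.max 0%R ((g x - k) / c)%R.
have mg' : measurable_fun setT g'.
  by apply: measurable_maxr => //; apply: measurable_funM => //; apply: measurable_funB.
have g'M x : (`|g' x| <= (M + `|k|) / c)%R.
  rewrite ger0_norm ?le_max ?lexx// /g' ge_max; apply/andP; split.
    by apply: divr_ge0 (ltW c0); apply: addr_ge0 => //; exact: le_trans (gM x).
  rewrite ler_pM2r ?invr_gt0// (le_trans (ler_norm _))// (le_trans (ler_normB _ _))//.
  by rewrite lerD.
have ig' : P.-integrable setT (EFin \o g') by exact: bounded_integrable g'M.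
have g'h x : (g' x)%:E <= h x.
  rewrite /g' EFin_max ge_max h0/=.
  move: (gh x) (h0 x); case: (h x) => [r + _| _ _|_]; rewrite ?leey//.
  by rewrite -EFinM -EFinD !lee_fin ler_pdivrMr// lerBlDl mulrC.
have gg' x : (g x <= k + c * g' x)%R.
  rewrite -lerBlDl mulrC -ler_pdivrMr// /g' le_max lexx orbT//.
apply: (@le_trans _ _ (\int[P]_x (k%:E + c%:E * (g' x)%:E))).
  by apply: integral_mono => x; rewrite -EFinM -EFinD lee_fin.
rewrite integralD//; last 2 first.
- exact: finite_measure_integrable_cst.
- exact: integrableZl.
rewrite integral_cst_prob integralZl// leeD2l// lee_wpmul2l ?lee_fin ?(ltW c0)//.
exact: integral_mono.
Qed.

Lemma Rintegral_bounded (f : T -> R) (M : R) : measurable_fun setT f ->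
  (forall x, (`|f x| <= M)%R) -> (`|\int[P]_x f x| <= M)%R.
Proof.
move=> mf fM; have iF := bounded_integrable mf fM.
apply: (le_trans (le_normr_Rintegral measurableT iF)).
rewrite -lee_fin /Rintegral fineK; last first.
  by apply: integrable_fin_num => //; exact: (integrable_abse iF).
rewrite -[leRHS]integral_cst_prob.
by apply: integral_mono => x; rewrite lee_fin.
Qed.

Lemma Rintegral_dist (f g : T -> R) (M e : R) :
  measurable_fun setT f -> (forall x, (`|f x| <= M)%R) ->
  measurable_fun setT g -> (forall x, (`|g x| <= M)%R) ->
  (forall x, (`|f x - g x| <= e)%R) ->
  (`|\int[P]_x f x - \int[P]_x g x| <= e)%R.
Proof.
move=> mf fM mg gM fg; rewrite -RintegralB//; last 2 first.
- exact: bounded_integrable fM.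
- exact: bounded_integrable gM.
by apply: Rintegral_bounded => //; exact: measurable_funB.
Qed.

End LowerIntegral.

(** * Integration against empirical measures *)

Section EmpiricalIntegral.
Import HBNNSimple.
Local Open Scope ereal_scope.
Context (R : realType) d (T : measurableType d) (n : nat) (s : 'I_n.+1 -> T).

Lemma ge0_integral_empirical (f : T -> \bar R) :
  measurable_fun setT f -> (forall x, 0 <= f x) ->
  \int[empirical R s]_x f x = (n.+1%:R^-1)%:E * \sum_(i < n.+1) f (s i).
Proof.
move=> mf f0.
pose D (i : nat) : {measure set T -> \bar R} := \d_(s (inord i)).
have c0 : (0 <= n.+1%:R^-1 :> R)%R by rewrite invr_ge0.
pose c := NngNum c0.
rewrite (eq_measure_integral (mscale c (msum D n.+1))); last first.
  move=> A _ _; rewrite /= /empirical /mscale /msum/=; congr (_ * _).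
  by apply: eq_bigr => i _; rewrite /D inord_val.
rewrite ge0_integral_mscale// ge0_integral_measure_sum//; congr (_ * _).
apply: eq_bigr => i _; rewrite integral_dirac//= diracT mul1e.
by rewrite inord_val.
Qed.

(** Only simple functions below h get integrated, and each is at most r at every atom. *)
Lemma integral_empirical_le (h : T -> \bar R) (r : R) : (forall x, 0 <= h x) ->
  (forall i, h (s i) <= r%:E) -> \int[empirical R s]_x h x <= r%:E.
Proof.
move=> h0 hr; rewrite ge0_integralTE//; apply: ge_ereal_sup => /= _ [f /= fh <-].
have -> : sintegral (empirical R s) f = \int[empirical R s]_x (f x)%:E.
  by rewrite integral_nnsfun// patch_setT.
rewrite ge0_integral_empirical//; last 2 first.
- exact/measurable_EFinP.
- by move=> x; rewrite lee_fin.
apply: (@le_trans _ _ ((n.+1%:R^-1)%:E * \sum_(i < n.+1) r%:E)).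
  rewrite lee_wpmul2l ?lee_fin ?invr_ge0//.
  by apply: lee_sum => i _; exact: le_trans (fh _) (hr _).
by rewrite sumEFin -EFinM sumr_const card_ord -[(r *+ _)%R]mulr_natl mulKf.
Qed.

(** Adding M makes the integrand nonnegative and adds M to both sides, the total mass being 1. *)
Lemma integral_empirical (g : T -> R) (M : R) :
  measurable_fun setT g -> (forall x, (`|g x| <= M)%R) ->
  \int[empirical R s]_x (g x)%:E = (n.+1%:R^-1 * \sum_(i < n.+1) g (s i))%:E.
Proof.
move=> mg gM.
have mgM : measurable_fun setT (fun x => (g x + M)%R) by exact: measurable_funD.
have gM0 x : (0 <= g x + M)%R by have := gM x; rewrite ler_norml; lra.
have := @ge0_integral_empirical (fun x => (g x + M)%:E)
  (proj2 (measurable_EFinP _ _) mgM) gM0.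
under eq_integral do rewrite EFinD.
rewrite (@integralD _ _ _ (empirical R s) _ measurableT (EFin \o g))//=; last 2 first.
- exact: bounded_integrable gM.
- exact: finite_measure_integrable_cst.
rewrite integral_cst_prob sumEFin big_split/= sumr_const card_ord -EFinM mulrDr.
rewrite -[(M *+ _)%R]mulr_natl mulKf// EFinD.
have /integrable_fin_num/fineK <- := bounded_integrable (empirical R s) mg gM.
- by rewrite -!EFinD => -[] /addIr ->.
- exact: measurableT.
Qed.

End EmpiricalIntegral.

Section Marginals.
Local Open Scope ereal_scope.
Context (R : realType) d (T : measurableType d) (mu : probability T R).

Lemma integral_marginal d' (S : measurableType d') (g : probability S R)
    (p : S -> T) (f : T -> R) (M : R) :
  measurable_fun setT p -> (forall A, measurable A -> g (p @^-1` A) = mu A) ->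
  measurable_fun setT f -> (forall x, (`|f x| <= M)%R) ->
  \int[g]_u (f (p u))%:E = \int[mu]_x (f x)%:E.
Proof.
move=> mp gmu mf fM.
rewrite -(@eq_measure_integral _ _ _ _ _ (pushforward g p)); last first.
  by move=> A mA _; rewrite /= /pushforward gmu.
rewrite integral_pushforward ?preimage_setT//; first exact/measurable_EFinP.
apply: (@bounded_integrable _ _ _ g _ M) => //.
exact: measurableT_comp.
Qed.

End Marginals.

(** * From a pointwise excess bound to a bound in expectation *)

Section ExpectedExcess.
Local Open Scope ereal_scope.
Context d (T : measurableType d) (R : realType) (P : probability T R).
Variables (U : Type) (F : set U) (K : finType) (r : U -> R).
Variables (D : K -> U -> T -> R) (c : K -> R) (H : K -> T -> \bar R).
Variables (B kappa : R) (fs : U) (fh : T -> U).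

(** Here r is the risk, the [D k] are measurable deviations and the [H k] their possibly
    nonmeasurable bounds. Up to the mesh of the net, [D k (fh w)] and [D k fs] are both at most
    [A k w], a maximum over finitely many predictors. This [A k] is measurable and lies below c k H
    k, so the sum is split at the level of [A] and each integral enlarged afterwards. *)
Lemma expected_excess :
  F fs -> (forall w, F (fh w)) -> (forall k, 0 <= c k)%R ->
  (forall k w, 0 <= H k w) ->
  (forall k f, F f -> measurable_fun setT (D k f)) ->
  (forall k f w, F f -> (0 <= D k f w <= B)%R) ->
  (forall k f w, F f -> (D k f w)%:E <= (c k)%:E * H k w) ->
  (forall e : R, (0 < e)%R -> exists s : seq U, (forall g, List.In g s -> F g) /\
     forall f, F f -> exists2 g, List.In g s &
       forall k w, (D k f w <= D k g w + e)%R) ->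
  (forall w, r (fh w) - r fs <= \sum_k (D k (fh w) w + D k fs w) + kappa)%R ->
  \int[P]_w (r (fh w))%:E - (r fs)%:E <=
    \sum_k (2 * c k)%:E * \int[P]_w H k w + kappa%:E.
Proof.
move=> Ffs Ffh c0 H0 mD DB DH net excess.
suff main (e : R) : (0 < e)%R -> \int[P]_w (r (fh w))%:E - (r fs)%:E <=
    \sum_k (2 * c k)%:E * \int[P]_w H k w + kappa%:E + e%:E.
  exact/lee_addgt0Pr.
move=> e0.
(* The errors e / N, one for each k, add up to at most e; the successor keeps N positive when K is
   empty. *)
pose N : R := #|K|.*2.+1%:R.
have N0 : (0 < N)%R by rewrite ltr0n.
have [s [sF snet]] := net (e / N)%R (divr_gt0 e0 N0).
(* The comparison predictor [fs] joins the net because its own deviations also enter the excess. *)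
pose A k w := (\big[Num.max/0]_(g <- fs :: s) D k g w)%R.
have Fin g : List.In g (fs :: s) -> F g by case=> [<-//|/sF].
have AP k w (S : seq U) : (forall g, List.In g S -> F g) ->
    [/\ (0 <= \big[Num.max/0]_(g <- S) D k g w)%R,
        (\big[Num.max/0]_(g <- S) D k g w <= Num.max 0 B)%R,
        (\big[Num.max/0]_(g <- S) D k g w)%:E <= (c k)%:E * H k w &
        (forall g, List.In g S -> D k g w <= \big[Num.max/0]_(g <- S) D k g w)%R].
  elim: S => [|g S IH] FS.
    by rewrite big_nil; split => //; rewrite ?le_max ?lexx// mule_ge0// lee_fin.
  have [i1 i2 i3 i4] := IH (fun g' Sg' => FS g' (or_intror Sg')).
  have Fg := FS g (or_introl erefl).
  have /andP[d1 d2] := DB k g w Fg.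
  rewrite big_cons; split.
  - by rewrite le_max i1 orbT.
  - by rewrite ge_max i2 andbT le_max d2 orbT.
  - by rewrite EFin_max ge_max i3 DH.
  - by move=> g' [<-|/i4 h]; rewrite le_max ?lexx// h orbT.
have mA k : measurable_fun setT (A k).
  rewrite /A; elim: (fs :: s) Fin => [|g S IH] FS.
    by under eq_fun do rewrite big_nil; exact: measurable_cst.
  under eq_fun do rewrite big_cons.
  apply: measurable_maxr; first by apply: mD; apply: FS; left.
  by apply: IH => g' Sg'; apply: FS; right.
have iA k : P.-integrable setT (EFin \o A k).
  apply: (@bounded_integrable _ _ _ _ _ (Num.max 0 B)%R) => // w.
  by have [a0 aB _ _] := AP k w _ Fin; rewrite ger0_norm.
have AH k : \int[P]_w (A k w)%:E <= (c k)%:E * \int[P]_w H k w.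
  rewrite -[leRHS]add0e.
  apply: (@integral_le_affine _ _ _ _ _ (Num.max 0 B)%R) => // w.
    by have [a0 aB _ _] := AP k w _ Fin; rewrite ger0_norm.
  by rewrite add0e; have [] := AP k w _ Fin.
pose G w := (\sum_k 2 * A k w)%R.
have rG w : (r (fh w) <= G w + (r fs + kappa + e))%R.
  have [g sg gle] := snet _ (Ffh w).
  have := excess w; rewrite lerBlDr => /le_trans; apply.
  have : (\sum_k (D k (fh w) w + D k fs w) <= \sum_k (2 * A k w + e / N))%R.
    apply: ler_sum => k _.
    have aD g' : List.In g' (fs :: s) -> (D k g' w <= A k w)%R.
      by have [_ _ _] := AP k w _ Fin; exact.
    have := aD fs (or_introl erefl); have := aD g (or_intror sg).
    have := gle k w; move: (A k w) (D k g w) (D k fs w) (D k (fh w) w) (e / N)%R.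
    move=> a x1 x2 x3 y h1 h2 h3.
    lra.
  rewrite [X in (_ <= X)%R -> _]big_split/= -/(G w) sumr_const -[(_ *+ _)%R]mulr_natl.
  have : (#|K|%:R * (e / N) <= e)%R.
    rewrite mulrCA ger_pMr// ler_pdivrMr// mul1r ler_nat.
    by rewrite -addnn -addnS leq_addr.
  move: (_ * _)%R => y h1 h2; lra.
have i2A k : P.-integrable setT (fun w => 2%:E * (A k w)%:E).
  exact: (integrableZl measurableT 2 (iA k)).
have iG : P.-integrable setT (EFin \o G).
  rewrite /G [X in integrable _ _ X](_ : _ = fun w => \sum_k 2%:E * (A k w)%:E).
    apply: integrable_sum => // k _; exact: i2A.
  by apply/funext => w /=; rewrite -sumEFin.
rewrite leeBlDr//.
  apply: (@le_trans _ _ (\int[P]_w ((G w)%:E + (r fs + kappa + e)%:E))).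
    by apply: integral_mono => w; rewrite -EFinD lee_fin.
  rewrite integralD//; last exact: finite_measure_integrable_cst.
  rewrite integral_cst_prob.
  have -> : \int[P]_w (G w)%:E = \sum_k 2%:E * \int[P]_w (A k w)%:E.
    under eq_integral do rewrite -sumEFin.
    rewrite (@integral_sum _ _ _ _ _ measurableT _ (fun k w => 2%:E * (A k w)%:E))//.
    by apply: eq_bigr => k _; rewrite (integralZl measurableT (iA k)).
  rewrite -!addeA -!EFinD; apply: leeD.
    apply: lee_sum => k _; rewrite EFinM -muleA lee_wpmul2l ?lee_fin//.
  by rewrite lee_fin; lra.
Qed.

End ExpectedExcess.

(** * Borel measurability and Euclidean partitions *)

Section BorelMeasurability.
Variable R : realType.

Lemma continuous_borel (T U : ptopologicalType) (f : T -> U) :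
  continuous f -> measurable_fun setT (f : borel T -> borel U).
Proof.
move=> /continuousP cf; apply: (@measurability _ _ (borel T) (borel U) setT f (@open U)) => //.
move=> _ [A oA <-]; rewrite setTI; apply: sub_sigma_algebra; exact: cf.
Qed.

Lemma continuous_borel_real (T : ptopologicalType) (f : T -> R) :
  continuous f -> measurable_fun setT (f : borel T -> R).
Proof.
move=> /continuousP cf; apply: (measurability _ (RGenOpens.measurableE R)).
move=> _ [A [a [b ->]] <-]; rewrite setTI; apply: sub_sigma_algebra; apply: cf.
exact: interval_open.
Qed.

Lemma measurable_fun_uniform_limit d (T : measurableType d) (g : T -> R) :
  (forall e, 0 < e -> exists2 h : T -> R, measurable_fun setT h &
     forall w, `|h w - g w| <= e) -> measurable_fun setT g.
Proof.
move=> approx.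
have /choice[h hP] (k : nat) : exists h : T -> R, measurable_fun setT h /\
    forall w, `|h w - g w| <= k.+1%:R^-1.
  have [|h mh hg] := approx k.+1%:R^-1; first by rewrite invr_gt0.
  by exists h.
apply: (measurable_fun_cvg (h := h)) => [k|w _]; first exact: (hP k).1.
apply/cvgrPdist_le => e e0; near=> k.
rewrite distrC (le_trans ((hP k).2 w))//.
near: k; have [N _ HN] := near_infty_natSinv_lt (PosNum e0).
by exists N => // k /= Nk; apply: ltW; exact: HN.
Unshelve. all: by end_near. Qed.

Lemma measurable_fun_finType d (T : measurableType d) (I : finType) (c : T -> I)
    (g : I -> R) :
  (forall i, measurable (c @^-1` [set i])) -> measurable_fun setT (g \o c).
Proof.
move=> mc _ B mB; rewrite setTI.
rewrite (_ : _ @^-1` _ = \bigcup_(i in [set i | B (g i)]) c @^-1` [set i]).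
  by apply: fin_bigcup_measurable => // i _; exact: mc.
apply/seteqP; split=> [w Bw|w [i Bi /= wi]]; last by rewrite /= wi.
by exists (c w).
Qed.

End BorelMeasurability.

(** * Fine Borel partitions and uniformly continuous functions *)

Section FinePartitions.
Variable R : realType.

(** Total boundedness for D with Borel cells, the partition being encoded by the map c from points
    to cells. *)
Definition finely_partitioned (T : ptopologicalType) (D : T -> T -> R) :=
  forall e : R, 0 < e -> exists (I : finType) (c : T -> I),
    (forall i, measurable (c @^-1` [set i] : set (borel T))) /\
    forall x y, c x = c y -> D x y <= e.

(** Replacing each [u j w] by a representative of its cell gives a function of finitely many cells,
    hence a measurable one, and by uniform continuity it is uniformly close to the target. The Borel
    sets of a product are thus never compared with the product of Borel sigma-algebras. *)
Lemma measurable_fun_uniform (T : ptopologicalType) (D : T -> T -> R)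
    d (W : measurableType d) (J : finType) (u : J -> W -> borel T)
    (G : (J -> T) -> R) :
  finely_partitioned D ->
  (forall j, measurable_fun setT (u j)) ->
  (forall e, 0 < e -> exists2 del, 0 < del & forall a b : J -> T,
     (forall j, D (a j) (b j) <= del) -> `|G a - G b| <= e) ->
  measurable_fun setT (fun w => G (fun j => u j w)).
Proof.
move=> TD mu Gunif; apply: measurable_fun_uniform_limit => e e0.
have [del del0 Gdel] := Gunif e e0.
have [I [c [mc cD]]] := TD del del0.
pose rep i := xget point (c @^-1` [set i]).
have crep x : c (rep (c x)) = c x.
  by rewrite /rep; case: xgetP => [y _ //|/(_ x) /=].
pose cc w : {ffun J -> I} := [ffun j => c (u j w)].
exists ((fun t : {ffun J -> I} => G (fun j => rep (t j))) \o cc).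
  apply: measurable_fun_finType => t.
  rewrite (_ : _ @^-1` _ = \bigcap_(j in [set: J]) (u j @^-1` (c @^-1` [set t j]))).
    apply: fin_bigcap_measurable => // j _; rewrite -[X in measurable X]setTI.
    by apply: mu => //; exact: mc.
  apply/seteqP; split=> [w /= <- j _ /=|w /= tw]; first by rewrite ffunE.
  by apply/ffunP => j; rewrite ffunE; exact: tw.
move=> w /=; apply: Gdel => j; apply: cD; rewrite ffunE; exact: crep.
Qed.

End FinePartitions.

(** * Euclidean distances and grids on compact sets *)

Section EuclideanGeometry.
Variable R : realType.

(** The factor d + 1 is cruder than sqrt d but positive for d = 0 too, so that it may be divided
    by. *)
Lemma enorm_le d (v : 'rV[R]_d) (e : R) : 0 <= e ->
  (forall i, `|v ord0 i| <= e) -> enorm v <= d.+1%:R * e.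
Proof.
move=> e0 ve; rewrite /enorm -[leRHS]ger0_norm; last by rewrite mulr_ge0.
rewrite -sqrtr_sqr ler_wsqrtr// (@le_trans _ _ (\sum_(i < d) e ^+ 2))//.
  by apply: ler_sum => i _; rewrite -real_normK ?num_real// lerXn2r ?nnegrE.
rewrite sumr_const card_ord -[_ *+ d]mulr_natl exprMn ler_wpM2r ?sqr_ge0//.
by rewrite -natrX ler_nat (leq_trans (leqnSn d))// -{1}(expn1 d.+1) leq_pexp2l.
Qed.

Lemma enorm_ge0 d (v : 'rV[R]_d) : 0 <= enorm v.
Proof. exact: sqrtr_ge0. Qed.

Lemma edist_nonneg d (K : compactSet R d) (x y : points K) : 0 <= edist x y.
Proof. exact: enorm_ge0. Qed.

Lemma edistxx d (K : compactSet R d) (x : points K) : edist x x = 0.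
Proof.
rewrite /edist subrr /enorm big1 ?sqrtr0// => i _.
by rewrite mxE expr0n.
Qed.

Lemma coord_bounded d (K : compactSet R d) :
  exists2 B : R, 0 < B & forall (x : points K) i, `|set_val x ord0 i| <= B.
Proof.
have [M [Mreal HM]] := compact_bounded (@carrier_compact R d K).
exists (`|M| + 1) => [|x i]; first by rewrite ltr_pwDr.
have Kx : carrier K (set_val x) by have := set_valP x.
have := HM (`|M| + 1) _ _ Kx; rewrite ltr_pwDr ?ler_norm// => /(_ isT).
by apply: le_trans; rewrite /Num.norm/= mx_normrE (bigD1 (ord0, i))//= le_max lexx.
Qed.

Lemma continuous_coord d (K : compactSet R d) i :
  continuous (fun x : points K => set_val x ord0 i).
Proof.
move=> x; apply: (@continuous_comp _ _ _ _ (fun v : 'rV[R]_d => v ord0 i)).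
  exact: initial_continuous.
exact: coord_continuous.
Qed.

(** The cells are those of a grid of side [eta]: a point is sent to the integer parts of its shifted
    and rescaled coordinates. They are Borel as preimages of half-open intervals under continuous
    coordinates. *)
Lemma edist_finely_partitioned d (K : compactSet R d) :
  finely_partitioned (@edist R d K).
Proof.
move=> e e0; have [B B0 KB] := coord_bounded K.
pose eta := e / d.+1%:R; have eta0 : 0 < eta by rewrite divr_gt0.
pose a i (x : points K) := (set_val x ord0 i + B) / eta.
have a0 i x : 0 <= a i x.
  by rewrite divr_ge0 ?(ltW eta0)//; have := KB x i; rewrite ler_norml; lra.
(* The coordinates lie in [-B, B], so the shifted ones are at most 2 B. *)
pose N := Num.truncn (2 * B / eta).
have aN i x : (Num.truncn (a i x) < N.+1)%N.
  rewrite ltnS le_truncn// ler_pM2r ?invr_gt0//.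
  by have := KB x i; rewrite ler_norml; lra.
exists {ffun 'I_d -> 'I_N.+1}, (fun x => [ffun i => inord (Num.truncn (a i x))]).
split=> [t|x y].
  rewrite (_ : _ @^-1` _ =
      \bigcap_(i in [set: 'I_d]) a i @^-1` `[(t i)%:R, (t i).+1%:R[).
    apply: fin_bigcap_measurable => // i _; rewrite -[X in measurable X]setTI.
    have : measurable_fun setT (a i : borel (points K) -> R).
      apply: measurable_funM => //; apply: measurable_funD => //.
      exact: (continuous_borel_real (@continuous_coord _ K i)).
    by apply.
  apply/seteqP; split=> [x /= <- i _ /=|x /= tx].
    by rewrite in_itv/= ffunE inordK// -truncn_eq.
  apply/ffunP => i; rewrite ffunE; apply: val_inj; rewrite /= inordK//.
  by have /= := tx i Logic.I; rewrite in_itv/= -truncn_eq// => /eqP.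
move=> /ffunP xy; rewrite /edist.
have -> : e = d.+1%:R * eta by rewrite /eta mulrC divfK.
apply: enorm_le => [|i]; first exact: ltW.
have := xy i; rewrite !ffunE => /(congr1 val); rewrite /= !inordK// => xyi.
have /andP[] := truncn_itv (a0 i x); have /andP[] := truncn_itv (a0 i y).
rewrite xyi; move: (Num.truncn _) => k.
rewrite /a !(ler_pdivlMr _ _ eta0) !(ltr_pdivrMr _ _ eta0).
have -> : k.+1%:R = k%:R + 1 :> R by rewrite -addn1 natrD.
rewrite mulrDl mul1r !mxE => h1 h2 h3 h4.
rewrite ler_norml; apply/andP; split; lra.
Qed.

Lemma edist_bounded d (K : compactSet R d) :
  exists B : R, forall x y : points K, edist x y <= B.
Proof.
have [B B0 KB] := coord_bounded K; exists (d.+1%:R * (B + B)) => x y.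
apply: enorm_le => [|i]; first by rewrite addr_ge0 ?ltW.
by rewrite !mxE (le_trans (ler_normB _ _))// lerD.
Qed.

Section Samples.
Variables (dx dy : nat) (X : compactSet R dx) (Y : compactSet R dy).
Implicit Types z : samples X Y.

(** Pythagoras for the two blocks of coordinates. *)
Lemma sdistE z z' :
  sdist z z' = Num.sqrt (edist z.1 z'.1 ^+ 2 + edist z.2 z'.2 ^+ 2).
Proof.
rewrite /sdist /edist /enorm !sqr_sqrtr ?sumr_ge0// => [|i _|i _]; last 2 first.
- exact: sqr_ge0.
- exact: sqr_ge0.
rewrite big_split_ord/=; congr (Num.sqrt (_ + _)); apply: eq_bigr => i _.
  by rewrite mxE [X in _ + X]mxE /concat !row_mxEl !mxE.
by rewrite mxE [X in _ + X]mxE /concat !row_mxEr !mxE.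
Qed.

Lemma sdist_ge0 z z' : 0 <= sdist z z'.
Proof. exact: enorm_ge0. Qed.

Lemma sdist_le z z' : sdist z z' <= edist z.1 z'.1 + edist z.2 z'.2.
Proof.
have h1 := edist_nonneg z.1 z'.1; have h2 := edist_nonneg z.2 z'.2.
rewrite sdistE -[leRHS]ger0_norm ?addr_ge0// -sqrtr_sqr ler_wsqrtr//.
by rewrite sqrrD lerD2r lerDl mulrn_wge0// mulr_ge0.
Qed.

Lemma edist_fst_le z z' : edist z.1 z'.1 <= sdist z z'.
Proof.
rewrite sdistE -[leLHS]ger0_norm ?edist_nonneg// -sqrtr_sqr ler_wsqrtr//.
by rewrite lerDl sqr_ge0.
Qed.

Lemma edist_snd_le z z' : edist z.2 z'.2 <= sdist z z'.
Proof.
rewrite sdistE -[leLHS]ger0_norm ?edist_nonneg// -sqrtr_sqr ler_wsqrtr//.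
by rewrite lerDr sqr_ge0.
Qed.

(** From (a + b)^2 <= 2 (a^2 + b^2); this is the origin of the factor sqrt 2 in [Clf]. *)
Lemma edistD_le z z' :
  edist z.1 z'.1 + edist z.2 z'.2 <= Num.sqrt 2 * sdist z z'.
Proof.
have h1 := edist_nonneg z.1 z'.1; have h2 := edist_nonneg z.2 z'.2.
rewrite sdistE -sqrtrM// -[leLHS]ger0_norm ?addr_ge0// -sqrtr_sqr ler_wsqrtr//.
have := sqr_ge0 (edist z.1 z'.1 - edist z.2 z'.2).
rewrite sqrrB sqrrD mulrDr !mulr2n; lra.
Qed.

Lemma sdist_finely_partitioned : finely_partitioned (@sdist R dx dy X Y).
Proof.
move=> e e0.
have [|I [c [mc cX]]] := @edist_finely_partitioned dx X (e / 2); first by rewrite divr_gt0.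
have [|J [c' [mc' cY]]] := @edist_finely_partitioned dy Y (e / 2); first by rewrite divr_gt0.
exists (I * J)%type, (fun z => (c z.1, c' z.2)); split=> [[i j]|z z' [/cX h1 /cY h2]].
  rewrite (_ : _ @^-1` _ = (fst @^-1` (c @^-1` [set i]) : set (borel (samples X Y))) `&`
      snd @^-1` (c' @^-1` [set j])).
    apply: measurableI.
      have : measurable_fun setT (fst : borel (samples X Y) -> borel (points X)).
        by apply: continuous_borel => z; exact: cvg_fst.
      by move=> /(_ measurableT _ (mc i)); rewrite setTI.
    have : measurable_fun setT (snd : borel (samples X Y) -> borel (points Y)).
      by apply: continuous_borel => z; exact: cvg_snd.
    by move=> /(_ measurableT _ (mc' j)); rewrite setTI.
  by apply/seteqP; split=> z /=; [case=> <- <-|case=> -> ->].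
by rewrite (le_trans (sdist_le _ _))//; lra.
Qed.

Lemma sdist_bounded : exists B : R, forall z z', sdist z z' <= B.
Proof.
have [B1 h1] := edist_bounded X; have [B2 h2] := edist_bounded Y.
by exists (B1 + B2) => z z'; rewrite (le_trans (sdist_le _ _))// lerD.
Qed.

End Samples.

End EuclideanGeometry.

(** * The weak topology on probability measures *)

Section WeakMeasurability.
Variables (R : realType) (T : ptopologicalType).

(** The integral of phi is one coordinate of the map that defines the weak topology, hence
    continuous in mu. *)
Lemma integral_bounded_continuous_measurable (phi : T -> R) (M : R) :
  continuous phi -> (forall x, `|phi x| <= M) ->
  measurable_fun setT (fun mu : borel (Prob R T) =>
    (\int[(mu : probability (borel T) R)]_x (phi x)%:E)%E).
Proof.
move=> cphi phiM.
pose b : bounded_continuous R T := exist _ phi (conj cphi (ex_intro _ M phiM)).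
have mb : measurable_fun setT (fun mu : borel (Prob R T) => integrate mu b).
  apply: continuous_borel_real => mu.
  have ci : continuous (@integrate R T : Prob R T -> {ptws bounded_continuous R T -> R}).
    exact: initial_continuous.
  have cp : continuous (fun g : {ptws bounded_continuous R T -> R} => g b).
    exact: (@proj_continuous {classic (bounded_continuous R T)} (fun=> R) b).
  exact: (continuous_comp (ci mu) (cp _)).
rewrite (_ : (fun mu => _) = fun mu : borel (Prob R T) => (integrate mu b)%:E).
  exact/measurable_EFinP.
apply/funext => mu; rewrite /integrate /Rintegral fineK//.
apply: integrable_fin_num => //.
apply: (@bounded_integrable _ _ _ (mu : probability (borel T) R) phi M) => //.
exact: continuous_borel_real.
Qed.

End WeakMeasurability.

(** * Tasks as a measurable kernel *)

Section EvaluationMeasurability.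
Context (R : realType) (dx dy : nat) (X : compactSet R dx) (Y : compactSet R dy).
Local Notation Z := (samples X Y).

(** The function [phi k] separates the complement of U, where it is 0, from the points whose ball of
    radius 1 / (k + 1) lies in U, where it is 1. As U is open, each of its points is eventually of
    the second kind. *)
Lemma indic_open_approx (U : set Z) : open U ->
  exists phi : nat -> Z -> R, [/\ forall k, continuous (phi k),
    forall k x, `|phi k x| <= 1 &
    forall x, (fun k => phi k x) @ \oo --> (\1_U x : R)].
Proof.
move=> oU.
have sep (k : nat) : exists f : Z -> R, [/\ continuous f, range f `<=` `[0, 1],
    f @` (~` U) `<=` [set 0] & f @` [set x | ball x k.+1%:R^-1 `<=` U] `<=` [set 1]].
  apply/uniform_separatorP/uniform_separatorW.
  exists [set xy | ball xy.1 (k.+1%:R^-1 : R) xy.2].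
    by rewrite -entourage_ballE; exists k.+1%:R^-1 => //=; rewrite invr_gt0.
  apply/seteqP; split=> // -[x y] [[/= nUx yU] /ball_sym xy].
  by apply: nUx; exact: yU.
have /choice[phi phiP] := sep; exists phi; split=> [k|k x|x].
- by have [] := phiP k.
- have [_ + _ _] := phiP k => /(_ (phi k x)); rewrite /= in_itv/=.
  by case/(_ _)/andP=> [|h1 h2]; [exists x|rewrite ger0_norm].
- have [Ux|nUx] := pselect (U x); last first.
    rewrite indicE memNset//.
    rewrite (_ : (fun k => phi k x) = cst 0); first exact: cvg_cst.
    by apply/funext => k /=; have [_ _ + _] := phiP k => /(_ (phi k x)); apply; exists x.
  rewrite indicE mem_set//; apply: cvg_near_cst.
  have /nbhs_ballP[e /= e0 xeU] : nbhs x U by exact: open_nbhs_nbhs.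
  have [N _ HN] := near_infty_natSinv_lt (PosNum e0).
  exists N => // k /= Nk; have [_ _ _ +] := phiP k => /(_ (phi k x)); apply.
  by exists x => //= y xy; apply: xeU; apply: le_ball xy; exact/ltW/HN.
Qed.

(** A Dynkin argument: open sets are a generating pi-system, and on them evaluation is a limit of
    integrals of bounded continuous functions, by dominated convergence. *)
Lemma measurable_evaluation (A : set (borel Z)) : measurable A ->
  measurable_fun setT (fun mu : borel (task X Y) =>
    (mu : probability (borel Z) R) A).
Proof.
apply: (@dynkin_induction _ (borel Z) (@open Z)
  (fun A : set (borel Z) => measurable_fun setT (fun mu : borel (task X Y) =>
    (mu : probability (borel Z) R) A))) => //.
- by move=> U V oU oV; exact: openI.
- rewrite (_ : (fun mu => _) = cst 1%E); first exact: measurable_cst.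
  by apply/funext => mu; exact: probability_setT.
- move=> U oU; have [phi [cphi phi1 phiU]] := indic_open_approx oU.
  have mU : measurable (U : set (borel Z)) by exact: sub_sigma_algebra.
  apply: (@emeasurable_fun_cvg _ _ _ _ (fun k (mu : borel (task X Y)) =>
    (\int[(mu : probability (borel Z) R)]_x (phi k x)%:E)%E)).
    by move=> k; exact: integral_bounded_continuous_measurable (phi1 k).
  move=> mu _.
  have <- : (\int[(mu : probability (borel Z) R)]_x (\1_U x)%:E =
      (mu : probability (borel Z) R) U)%E.
    by rewrite integral_indic// setIT.
  apply: (@dominated_cvg _ _ _ _ _ measurableT _ _ (cst 1%E)) => //.
  + by move=> k; apply/measurable_EFinP; exact: continuous_borel_real.
  + by move=> x _; apply: cvg_EFin; [exact: nearW|exact: phiU].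
  + exact: finite_measure_integrable_cst.
  + by move=> k x _; rewrite lee_fin.
- move=> S mS mmS; under eq_fun do rewrite probability_setC//.
  exact: emeasurable_funB.
- move=> F mF tF mmF; under eq_fun do rewrite measure_bigcup//.
  by apply: ge0_emeasurable_sum => [k x _ _|k _]; [exact: measure_ge0|exact: mmF].
Qed.

(** The identity, viewed as a probability kernel from tasks to samples, so that integrals with a
    parameter become measurable in it. *)
Definition task_kernel (mu : borel (task X Y)) : {measure set (borel Z) -> \bar R} :=
  (mu : probability (borel Z) R).

HB.instance Definition _ :=
  isKernel.Build _ _ _ _ R task_kernel measurable_evaluation.

Let task_kernelT mu : task_kernel mu setT = 1%E.
Proof. exact: probability_setT. Qed.

HB.instance Definition _ :=
  Kernel_isProbability.Build _ _ _ _ R task_kernel task_kernelT.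

(** The result on kernels concerns nonnegative integrands, hence the shift by M, which is subtracted
    again after integration. *)
Lemma measurable_Rintegral_task (k : borel (task X Y) * borel Z -> R) (M : R) :
  measurable_fun setT k -> (forall u, `|k u| <= M) ->
  measurable_fun setT (fun mu : borel (task X Y) =>
    \int[(mu : probability (borel Z) R)]_z k (mu, z)).
Proof.
move=> mk kM.
have kM0 u : (0 <= (k u + M)%:E)%E.
  by rewrite lee_fin; have := kM u; rewrite ler_norml; lra.
have mkM : measurable_fun setT (fun u => (k u + M)%:E).
  by apply/measurable_EFinP; exact: measurable_funD.
have := measurable_fun_integral_finite_kernel _ task_kernel kM0 mkM.
move=> /(measurableT_comp (fine_measurable _)) mI.
have -> : (fun mu : borel (task X Y) =>
    \int[(mu : probability (borel Z) R)]_z k (mu, z)) =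
  (fun mu => fine (\int[task_kernel mu]_z (k (mu, z) + M)%:E)%E - M).
  apply/funext => mu.
  have ik : (task_kernel mu).-integrable setT (EFin \o (fun z => k (mu, z))).
    apply: (@bounded_integrable _ _ _ (mu : probability (borel Z) R) _ M) => //.
    exact: measurable_fun_pair2.
  have ic : (task_kernel mu).-integrable setT (fun=> M%:E).
    exact: (finite_measure_integrable_cst (mu : probability (borel Z) R)).
  under eq_integral do rewrite EFinD.
  rewrite (@integralD _ _ _ (task_kernel mu) _ measurableT (EFin \o (fun z => k (mu, z))))//.
  rewrite fineD ?integrable_fin_num//.
  by rewrite (integral_cst_prob (mu : probability (borel Z) R)) /= addrK.
by apply: measurable_funB => //; exact: mI.
Qed.

End EvaluationMeasurability.

(** * Couplings *)

Section CommonMass.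
Variables (R : realType) (I : finType).
Implicit Types a b m : I -> R.

(* The common mass [m] stays on the diagonal and the remainders [a - m] and
   [b - m] are coupled independently; when [m] has mass [1], both remainders are
   [0] and so is the junk value of the quotient. *)
Definition common_mass_weight a b m i j : R :=
  m i *+ (i == j) + (a i - m i) * (b j - m j) / (1 - \sum_k m k).

Lemma common_mass_weightC a b m i j :
  common_mass_weight a b m i j = common_mass_weight b a m j i.
Proof.
rewrite /common_mass_weight eq_sym [(b j - _) * _]mulrC; congr (_ + _).
by case: eqP => [->|].
Qed.

Variables (a b m : I -> R).
Hypotheses (m0 : forall i, 0 <= m i) (ma : forall i, m i <= a i)
  (mb : forall i, m i <= b i) (a1 : \sum_i a i = 1) (b1 : \sum_i b i = 1).

Let rest_ge0 : 0 <= 1 - \sum_k m k.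
Proof. by rewrite subr_ge0 -a1 ler_sum. Qed.

Lemma common_mass_weight_ge i j : m i *+ (i == j) <= common_mass_weight a b m i j.
Proof. by rewrite lerDl !mulr_ge0 ?invr_ge0 ?subr_ge0// -subr_ge0. Qed.

Lemma common_mass_weight_ge0 i j : 0 <= common_mass_weight a b m i j.
Proof. by rewrite (le_trans _ (common_mass_weight_ge i j))// mulrn_wge0. Qed.

Lemma common_mass_weight_sum i : \sum_j common_mass_weight a b m i j = a i.
Proof.
rewrite big_split/=.
have -> : \sum_j m i *+ (i == j) = m i.
  rewrite (bigD1 i)//= eqxx mulr1n big1 ?addr0// => j.
  by rewrite eq_sym => /negbTE ->.
rewrite -mulr_suml -mulr_sumr sumrB b1.
(* If m has mass 1, each a i - m i is at most the sum of all of them, which is 0. *)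
have [r0|r0] := eqVneq (1 - \sum_k m k) 0; last by rewrite mulfK// subrKC.
rewrite r0 mulr0 mul0r addr0; apply/eqP; rewrite eq_le ma/= -subr_le0 -r0 -a1 -sumrB.
by rewrite (bigD1 i)//= lerDl sumr_ge0// => k _; rewrite subr_ge0.
Qed.

(** Ensures that the density w i j / (a i b j) loses no mass where its denominator is 0. *)
Lemma common_mass_weight_eq0 i j : a i * b j = 0 -> common_mass_weight a b m i j = 0.
Proof.
move=> ab0; rewrite /common_mass_weight.
have z x y : 0 <= x -> x <= y -> y = 0 -> x = 0 :> R.
  by move=> x0 xy y0; apply/eqP; rewrite eq_le x0 -y0 xy.
have [ai0|ai0] := eqVneq (a i) 0.
  by rewrite (z _ _ (m0 i) (ma i) ai0) ai0 subrr !mul0r mul0rn addr0.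
move/eqP: ab0; rewrite mulf_eq0 (negbTE ai0)/= => /eqP bj0.
rewrite (z _ _ (m0 j) (mb j) bj0) bj0 subrr mulr0 mul0r addr0.
by case: eqP => // ->; rewrite (z _ _ (m0 j) (mb j) bj0).
Qed.

End CommonMass.

Section FiniteDecomposition.
Local Open Scope ereal_scope.
Context (R : realType) d (T : measurableType d) (mu : {measure set T -> \bar R}).

(** Provides, as a genuine measure, the sum of the restrictions to the pieces [S p] with constant
    densities [k p]. *)
Lemma weighted_restrictions (P : finType) (k : P -> R) (S : P -> set T) :
  (forall p, (0 <= k p)%R) -> (forall p, measurable (S p)) ->
  exists g : {measure set T -> \bar R},
    forall A, g A = \sum_p (k p)%:E * mu (A `&` S p).
Proof.
move=> k0 mS; elim: (index_enum P) => [|p s [g gE]].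
  by exists mzero => A; rewrite big_nil.
exists (measure_add (mscale (NngNum (k0 p)) (mrestr mu (mS p))) g) => A.
rewrite big_cons -gE; exact: measure_addE.
Qed.

Lemma measure_fibers (I : finType) (c : T -> I) (A : set T) :
  (forall i, measurable (c @^-1` [set i])) -> measurable A ->
  mu A = \sum_i mu (A `&` c @^-1` [set i]).
Proof.
move=> mc mA.
rewrite [in LHS](_ : A = \bigcup_(i in [set` enum I]) (A `&` c @^-1` [set i])); last first.
  rewrite -setI_bigcupr; apply/esym/setIidPl => x Ax.
  by exists (c x) => //=; rewrite mem_enum.
rewrite measure_fin_bigcup//; last 2 first.
- by move=> i j _ _ [x [[_ /= ->] [_ /= ->]]].
- by move=> i _; exact: measurableI.
by rewrite -fsbig_seq ?enum_uniq// big_enum.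
Qed.

End FiniteDecomposition.

Section Couplings.
Local Open Scope ereal_scope.
Variables (R : realType) (T : ptopologicalType).
Implicit Types mu nu : Prob R T.

Definition product_prob mu nu : probability (borel T * borel T)%type R :=
  (mu : probability (borel T) R) \x (nu : probability (borel T) R).

Lemma product_probE mu nu (A B : set (borel T)) :
  measurable A -> measurable B -> product_prob mu nu (A `*` B) = mu A * nu B.
Proof. by move=> mA mB; exact: product_measure1E. Qed.

Lemma product_coupling mu nu :
  couplings mu nu (product_prob mu nu).
Proof.
move=> A mA; rewrite !product_probE//; split.
  by rewrite [X in _ * X](_ : _ = 1) ?mule1//; exact: probability_setT.
by rewrite [X in X * _](_ : _ = 1) ?mul1e//; exact: probability_setT.
Qed.

Lemma coupling_fst mu nu g A : couplings mu nu g -> measurable A ->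
  g (fst @^-1` A) = mu A.
Proof.
move=> mug mA; rewrite -(mug A mA).1; congr (g _).
by apply/seteqP; split=> -[x y] //= [].
Qed.

Lemma coupling_snd mu nu g A : couplings mu nu g -> measurable A ->
  g (snd @^-1` A) = nu A.
Proof.
move=> mug mA; rewrite -(mug A mA).2; congr (g _).
by apply/seteqP; split=> -[x y] //= [].
Qed.

Section FiberMasses.
Variables (rho : Prob R T) (I : finType) (c : T -> I).
Hypothesis mc : forall i, measurable (c @^-1` [set i] : set (borel T)).

Lemma fiber_mass_sum A : measurable (A : set (borel T)) ->
  rho A = (\sum_i fine (rho (A `&` c @^-1` [set i])))%:E.
Proof.
move=> mA; rewrite -sumEFin.
rewrite (@measure_fibers _ _ _ (rho : probability (borel T) R) _ c)//.
apply: eq_bigr => i _; rewrite fineK//.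
by apply: (fin_num_measure (rho : probability (borel T) R)); exact: measurableI.
Qed.

Lemma fiber_mass_sum1 : (\sum_i fine (rho (c @^-1` [set i])) = 1)%R.
Proof.
have := fiber_mass_sum measurableT.
have -> : rho setT = 1 by exact: probability_setT.
by case=> ->; apply: eq_bigr => i _; rewrite setTI.
Qed.

End FiberMasses.

Section SharedFibers.
Variables (mu nu : Prob R T) (I : finType) (c : T -> I) (m : I -> R).
Hypothesis mc : forall i, measurable (c @^-1` [set i] : set (borel T)).
Let a i : R := fine (mu (c @^-1` [set i])).
Let b i : R := fine (nu (c @^-1` [set i])).
Hypotheses (m0 : forall i, (0 <= m i)%R) (ma : forall i, (m i <= a i)%R)
  (mb : forall i, (m i <= b i)%R).

(** On the product of the cells i and j the coupling has constant density w i j / (a i b j) with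
    respect to the product of mu and nu. Its marginals are right because w has row sums a and column
    sums b, and w leaves at least m i on the i-th diagonal cell. *)
Lemma shared_fibers_coupling : exists2 g, couplings mu nu g &
  g [set u | c u.1 <> c u.2] <= (1 - \sum_i m i)%:E.
Proof.
pose w := common_mass_weight a b m.
have a1 : (\sum_i a i = 1)%R by exact: fiber_mass_sum1.
have b1 : (\sum_i b i = 1)%R by exact: fiber_mass_sum1.
have w0 i j : (0 <= w i j)%R by exact: common_mass_weight_ge0.
pose prod := product_prob mu nu.
have a0 i : (0 <= a i)%R by exact: fine_ge0.
have b0 i : (0 <= b i)%R by exact: fine_ge0.
have [|p|g gE] := @weighted_restrictions R _ (borel T * borel T)%type prod (I * I)%type
    (fun p => w p.1 p.2 / (a p.1 * b p.2))%R
    (fun p => (c @^-1` [set p.1]) `*` (c @^-1` [set p.2])).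
- by move=> p; rewrite divr_ge0// mulr_ge0.
- by apply: measurableX; exact: mc.
have {}gE A : g A = \sum_p (w p.1 p.2 / (a p.1 * b p.2))%:E * product_prob mu nu
    (A `&` (c @^-1` [set p.1]) `*` (c @^-1` [set p.2])).
  exact: gE.
have fib_fin (rho : Prob R T) A : measurable (A : set (borel T)) ->
    rho A = (fine (rho A))%:E.
  by move=> mA; rewrite fineK//; exact: (fin_num_measure (rho : probability (borel T) R)).
have gX (A B : set (borel T)) : measurable A -> measurable B ->
    g (A `*` B) = (\sum_p w p.1 p.2 / (a p.1 * b p.2) *
      (fine (mu (A `&` c @^-1` [set p.1])) * fine (nu (B `&` c @^-1` [set p.2]))))%:E.
  move=> mA mB; rewrite gE -sumEFin; apply: eq_bigr => p _.
  rewrite -setXI product_probE; [|exact: measurableI|exact: measurableI].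
  rewrite [mu _]fib_fin; last exact: measurableI.
  by rewrite [nu _]fib_fin; last exact: measurableI.
have le_fib (rho : Prob R T) (A : set (borel T)) i : measurable A ->
    (0 <= fine (rho (A `&` c @^-1` [set i])) <= fine (rho (c @^-1` [set i])))%R.
  move=> mA; rewrite fine_ge0//= -lee_fin -!fib_fin//; last exact: measurableI.
  apply: (@le_measure _ _ _ (rho : probability (borel T) R)); rewrite ?inE//.
  exact: measurableI.
(* Covers cells of mass 0 as well: there x <= y forces x = 0. *)
have zerodiv x y : (0 <= x <= y -> x / y * y = x :> R)%R.
  have [->|y0 _] := eqVneq y 0%R; last by rewrite divfK.
  by rewrite mulr0 => h; apply/eqP; rewrite eq_le.
have cancel (u v x y : R) : y != 0%R -> (u / (v * y) * (x * y) = x / v * u)%R.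
  by move=> y0; rewrite invfM; move: (v^-1)%R => v'; field.
have marg1 A : measurable A -> g (A `*` setT) = mu A.
  move=> mA; rewrite gX// (fiber_mass_sum mu mc mA) -(pair_bigA _ (fun i j => w i j / (a i * b j) *
      (fine (mu (A `&` c @^-1` [set i])) * fine (nu (setT `&` c @^-1` [set j]))))%R)/=.
  congr (_%:E); apply: eq_bigr => i _.
  rewrite -[RHS](zerodiv _ _ (le_fib mu A i mA)) -/(a i).
  rewrite -[X in (_ = _ * X)%R](common_mass_weight_sum ma a1 b1) mulr_sumr.
  apply: eq_bigr => j _; rewrite setTI -/(b j) -/(w i j).
  have [bj0|bj0] := eqVneq (b j) 0%R; last exact: cancel.
  by rewrite /w common_mass_weight_eq0 ?bj0 ?(mul0r, mulr0).
have marg2 A : measurable A -> g (setT `*` A) = nu A.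
  move=> mA; rewrite gX// (fiber_mass_sum nu mc mA) -(pair_bigA _ (fun i j => w i j / (a i * b j) *
      (fine (mu (setT `&` c @^-1` [set i])) * fine (nu (A `&` c @^-1` [set j]))))%R)/=.
  rewrite exchange_big/=; congr (_%:E); apply: eq_bigr => j _.
  rewrite -[RHS](zerodiv _ _ (le_fib nu A j mA)) -/(b j).
  rewrite -[X in (_ = _ * X)%R](common_mass_weight_sum mb b1 a1) mulr_sumr.
  apply: eq_bigr => i _; rewrite setTI -/(a i) -common_mass_weightC -/(w i j).
  have [ai0|ai0] := eqVneq (a i) 0%R; last first.
    by rewrite [(a i * b j)%R]mulrC [(a i * _)%R]mulrC cancel.
  by rewrite /w common_mass_weight_eq0 ?ai0 ?(mul0r, mulr0).
have gT : g setT = 1.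
  by rewrite -setXTT marg1//; exact: probability_setT.
(* As g has mass 1, normalising leaves it unchanged and only supplies the structure of a
   probability; [prod] is the fallback value of the normalisation. *)
pose G : probability (borel T * borel T)%type R := mnormalize g prod.
have GE A : G A = g A.
  by rewrite /G /= /mnormalize gT/= onee_eq0/= invr1 mule1.
exists G; first by move=> A mA; rewrite !GE; split; [exact: marg1|exact: marg2].
have -> : G [set u | c u.1 <> c u.2] = (\sum_p w p.1 p.2 *+ (p.1 != p.2))%:E.
  rewrite GE gE -sumEFin; apply: eq_bigr => -[i j] _ /=.
  have [<-|ij] := eqVneq i j.
    rewrite [X in product_prob _ _ X](_ : _ = set0) ?measure0 ?mule0//.
    by apply/seteqP; split=> // -[x y] /= [xy [/= xi yi]]; apply: xy; rewrite xi yi.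
  rewrite [X in product_prob _ _ X](_ : _ = (c @^-1` [set i]) `*` (c @^-1` [set j])); last first.
    apply/seteqP; split=> -[x y] /=; first by case.
    by move=> [/= xi yj]; split=> //; rewrite xi yj; exact/eqP.
  rewrite product_probE// [mu _]fib_fin// [nu _]fib_fin// -!EFinM mulr1n.
  congr (_%:E); rewrite -/(a i) -/(b j).
  have [ab0|ab0] := eqVneq (a i * b j)%R 0%R; last by rewrite divfK.
  by rewrite ab0 mulr0 /w common_mass_weight_eq0.
(* Row by row, the mass off the diagonal is a i - w i i, at most a i - m i. *)
rewrite lee_fin -(pair_bigA _ (fun i j => w i j *+ (i != j)))%R/= -a1 -sumrB.
apply: ler_sum => i _; rewrite -(common_mass_weight_sum ma a1 b1 i) -/w.
rewrite (bigD1 i)//= eqxx mulr0n add0r [X in (_ <= X - _)%R](bigD1 i)//=.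
have := common_mass_weight_ge ma mb a1 i i; rewrite eqxx mulr1n -/(w i i) => wii.
rewrite (eq_bigr (w i)) => [|j /negbTE ji]; last by rewrite eq_sym ji.
by rewrite addrAC lerDr subr_ge0.
Qed.

End SharedFibers.

End Couplings.

(** * Upper bounds on transport costs, and differences of integrals bounded by them *)

Section TransportBounds.
Local Open Scope ereal_scope.
Variables (R : realType) (T : ptopologicalType).
Implicit Types (mu nu : Prob R T) (cost : T -> T -> \bar R).

Lemma transport_le_coupling cost mu nu g : couplings mu nu g ->
  transport cost mu nu <= \int[g]_u cost u.1 u.2.
Proof. by move=> mug; apply: ereal_inf_lbound; exists g. Qed.

Lemma transport_ge0 cost mu nu : (forall x y, 0 <= cost x y) ->
  0 <= transport cost mu nu.
Proof.
by move=> c0; apply: le_ereal_inf_tmp => _ [g _ <-]; exact: integral_ge0.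
Qed.

Lemma le_affine_transport (a k c : R) cost mu nu :
  (0 <= c)%R -> (forall x y, 0 <= cost x y) ->
  (forall g, couplings mu nu g -> a%:E <= k%:E + c%:E * \int[g]_u cost u.1 u.2) ->
  a%:E <= k%:E + c%:E * transport cost mu nu.
Proof.
rewrite le_eqVlt => /predU1P[<-|c0] cost0 ag.
  (* For c = 0 the claim is a <= k, which follows once some coupling exists: the product. *)
  by have := ag _ (product_coupling mu nu); rewrite !mul0e.
have : ((a - k) / c)%:E <= transport cost mu nu.
  apply: le_ereal_inf_tmp => _ [g mug <-]; have := ag g mug.
  have : 0 <= \int[g]_u cost u.1 u.2 by exact: integral_ge0.
  case: (\int[g]_u cost u.1 u.2) => [r _|_ _|//]; last exact: leey.
  by rewrite -EFinM -EFinD !lee_fin ler_pdivrMr// lerBlDl mulrC.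
have := transport_ge0 mu nu cost0.
case: (transport cost mu nu) => [r _|_ _|//]; last by rewrite gt0_muley ?lte_fin// leey.
by rewrite -EFinM -EFinD !lee_fin ler_pdivrMr// lerBlDl mulrC.
Qed.

(** Along a coupling both integrals live on the space of pairs, where the pointwise bound is
    integrated. There are two functions and an additive k because the loss itself changes with the
    context. The cost is any nonnegative function, so that [W1] can serve as one. *)
Lemma transport_difference (f1 f2 : T -> R) (M k c : R) cost mu nu :
  measurable_fun setT (f1 : borel T -> R) -> (forall x, (`|f1 x| <= M)%R) ->
  measurable_fun setT (f2 : borel T -> R) -> (forall x, (`|f2 x| <= M)%R) ->
  (0 <= c)%R -> (forall x y, 0 <= cost x y) ->
  (forall x y, (`|f1 x - f2 y|)%:E <= k%:E + c%:E * cost x y) ->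
  (`| \int[(mu : probability (borel T) R)]_x f1 x -
      \int[(nu : probability (borel T) R)]_x f2 x |%R)%:E <=
    k%:E + c%:E * transport cost mu nu.
Proof.
move=> mf1 f1M mf2 f2M c0 cost0 f12; apply: le_affine_transport => // g mug.
have mp1 : measurable_fun setT (fun u : borel T * borel T => f1 u.1).
  exact: measurableT_comp.
have mp2 : measurable_fun setT (fun u : borel T * borel T => f2 u.2).
  exact: measurableT_comp.
have ig1 : g.-integrable setT (EFin \o (fun u => f1 u.1)).
  exact: (@bounded_integrable _ _ _ g _ M).
have ig2 : g.-integrable setT (EFin \o (fun u => f2 u.2)).
  exact: (@bounded_integrable _ _ _ g _ M).
have -> : (\int[(mu : probability (borel T) R)]_x f1 x = \int[g]_u f1 u.1)%R.
  rewrite /Rintegral; congr fine; apply/esym.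
  apply: (@integral_marginal R _ _ (mu : probability (borel T) R) _ _ g fst f1 M) => //.
  by move=> A mA; exact: (coupling_fst mug mA).
have -> : (\int[(nu : probability (borel T) R)]_x f2 x = \int[g]_u f2 u.2)%R.
  rewrite /Rintegral; congr fine; apply/esym.
  apply: (@integral_marginal R _ _ (nu : probability (borel T) R) _ _ g snd f2 M) => //.
  by move=> A mA; exact: (coupling_snd mug mA).
rewrite -RintegralB//.
have m12 : measurable_fun setT (fun u : borel T * borel T => f1 u.1 - f2 u.2)%R.
  exact: measurable_funB.
have mn12 : measurable_fun setT (fun u : borel T * borel T => `|f1 u.1 - f2 u.2|)%R.
  exact: measurableT_comp.
have b12 u : (`|f1 u.1 - f2 u.2| <= M + M)%R.
  by rewrite (le_trans (ler_normB _ _))// lerD.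
apply: (@le_trans _ _ (\int[g]_u (`|f1 u.1 - f2 u.2|%R)%:E)).
  rewrite EFin_normr_Rintegral//; last exact: (@bounded_integrable _ _ _ g _ (M + M)).
  apply: le_abse_integral => //; exact/measurable_EFinP.
apply: (@integral_le_affine _ _ _ g _ (M + M)) => // u.
by rewrite normr_id.
Qed.

(** Couples the i-th atom with the i-th atom. *)
Lemma transport_empirical_le n (s s' : 'I_n.+1 -> T) cost (r : R) :
  (forall x y, 0 <= cost x y) -> (forall i, cost (s i) (s' i) <= r%:E) ->
  transport cost (empirical_prob R s) (empirical_prob R s') <= r%:E.
Proof.
move=> cost0 ssr.
pose g : probability (borel T * borel T)%type R :=
  empirical R (fun i => (s i, s' i) : borel T * borel T).
apply: (le_trans (@transport_le_coupling _ _ _ g _)).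
  move=> A mA; rewrite /g /= /empirical /=; split; congr (_ * _);
    apply: eq_bigr => i _; rewrite !diracE in_setX/= in_setT ?andbT//.
exact: (@integral_empirical_le _ _ (borel T * borel T)%type _
  (fun i => (s i, s' i)) (fun u => cost u.1 u.2)).
Qed.

(** Under the coupling that keeps the shared mass m in its cells, the cost is at most e on pairs in
    a common cell and at most B on the others. *)
Lemma transport_fibers_le (cost : T -> T -> R) mu nu (I : finType) (c : T -> I)
    (B e : R) (m : I -> R) :
  (forall i, measurable (c @^-1` [set i] : set (borel T))) ->
  (forall x y, (0 <= cost x y <= B)%R) ->
  (forall x y, c x = c y -> (cost x y <= e)%R) -> (0 <= e)%R ->
  (forall i, (0 <= m i)%R) ->
  (forall i, (m i <= fine (mu (c @^-1` [set i])))%R) ->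
  (forall i, (m i <= fine (nu (c @^-1` [set i])))%R) ->
  transport (fun x y => (cost x y)%:E) mu nu <= (e + B * (1 - \sum_i m i))%:E.
Proof.
move=> mc costB coste e0 m0 mmu mnu.
have [g mug goff] := shared_fibers_coupling mc m0 mmu mnu.
apply: (le_trans (transport_le_coupling _ mug)).
set off := [set u | _] in goff.
have moff : measurable (off : set (borel T * borel T)).
  rewrite (_ : off = ~` \bigcup_(i in [set: I]) ((c @^-1` [set i]) `*` (c @^-1` [set i]))).
    apply: measurableC; apply: fin_bigcup_measurable => // i _.
    by apply: measurableX; exact: mc.
  rewrite /off; apply/seteqP; split=> -[x y] /=.
    by move=> xy [i _ [/= xi yi]]; apply: xy; rewrite xi yi.
  by move=> nxy xy; apply: nxy; exists (c x).
have B0 : (0 <= B)%R by have /andP[h1 h2] := costB point point; exact: le_trans h2.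
have mi : measurable_fun setT (fun u : borel T * borel T => B * \1_off u)%R.
  by apply: measurable_funM => //; exact: measurable_indic.
apply: (@le_trans _ _ (\int[g]_u (e%:E + (B * \1_off u)%:E))).
  apply: integral_mono => -[x y] /=; rewrite -EFinD lee_fin indicE.
  have [xy|xy] := pselect (c x = c y).
    by rewrite (le_trans (coste _ _ xy))// lerDl mulr_ge0.
  rewrite mem_set// mulr1; have /andP[_ h] := costB x y.
  by rewrite (le_trans h)// lerDr.
have ib : g.-integrable setT (EFin \o (fun u => B * \1_off u)%R).
  apply: (@bounded_integrable _ _ _ g _ B) => // u.
  by rewrite ger0_norm ?mulr_ge0// indicE; case: (_ \in _); rewrite ?mulr1 ?mulr0.
rewrite (@integralD _ _ _ g _ measurableT (cst e%:E)
  (EFin \o (fun u => B * \1_off u)%R))//=; last first.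
  exact: finite_measure_integrable_cst.
rewrite integral_cst_prob EFinD leeD2l//.
under eq_integral do rewrite EFinM.
rewrite ge0_integralZl_EFin//; last first.
  by apply/measurable_EFinP; exact: measurable_indic.
by rewrite integral_indic// setIT EFinM lee_wpmul2l.
Qed.

End TransportBounds.

(** * Tasks and risks *)

(** The representatives have to belong to F, so only the classes that meet F receive one. *)
Lemma finite_representatives (U : Type) (F : set U) (K : finType) (cl : U -> K) :
  exists s : seq U, (forall g, List.In g s -> F g) /\
    forall f, F f -> exists2 g, List.In g s & cl f = cl g.
Proof.
have [s [sF scl]] : exists s : seq U, (forall g, List.In g s -> F g) /\
    forall f, F f -> cl f \in enum K -> exists2 g, List.In g s & cl f = cl g.
  elim: (enum K) => [|k ks [s [sF scl]]]; first by exists [::].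
  have [[f0 [Ff0 f0k]]|nk] := pselect (exists f0, F f0 /\ cl f0 = k).
    exists (f0 :: s); split=> [g [<-//|/sF//]|f Ff].
    rewrite inE => /orP[/eqP fk|/(scl f Ff)[g sg fg]]; last by exists g => //; right.
    by exists f0; [left|rewrite fk f0k].
  exists s; split=> // f Ff; rewrite inE => /orP[/eqP fk|]; last exact: scl.
  by exfalso; apply: nk; exists f.
by exists s; split=> // f Ff; apply: scl => //; rewrite mem_enum.
Qed.

(** * Finiteness of [W1] and total boundedness of the tasks *)

Section WassersteinTasks.
Context (R : realType) (dx dy : nat) (X : compactSet R dx) (Y : compactSet R dy).
Local Notation Z := (samples X Y).
Implicit Types rho : task X Y.

Lemma W1_ge0 rho rho' : (0 <= W1 rho rho')%E.
Proof. by apply: transport_ge0 => z z'; rewrite lee_fin sdist_ge0. Qed.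

Lemma W1_fin_num rho rho' : W1 rho rho' \is a fin_num.
Proof.
rewrite ge0_fin_numE ?W1_ge0//; have [B sB] := sdist_bounded X Y.
apply: (@le_lt_trans _ _ B%:E); last exact: ltry.
apply: (le_trans (transport_le_coupling _ (product_coupling rho rho'))).
rewrite -[leRHS](integral_cst_prob (product_prob rho rho')).
by apply: integral_mono => u; rewrite lee_fin.
Qed.

(** A task is classified by its cell masses, rounded down to multiples of 1 / N. Two tasks of one
    class share the rounded masses; the unshared mass is at most 1 / N per cell and travels at most
    B. *)
Lemma W1_totally_bounded (e : R) : 0 < e -> exists (K : finType) (cl : task X Y -> K),
  forall rho rho', cl rho = cl rho' -> (W1 rho rho' <= e%:E)%E.
Proof.
move=> e0; have [B' sB'] := sdist_bounded X Y.
pose B := Num.max 1 B'; have B0 : 0 < B by rewrite lt_max ltr01.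
have sB z z' : 0 <= @sdist R dx dy X Y z z' <= B by rewrite sdist_ge0/= le_max sB' orbT.
have e20 : 0 < e / 2 by rewrite divr_gt0.
have [I [c [mc cs]]] := sdist_finely_partitioned X Y e20.
(* Makes B times the unshared mass at most e / 2; the other e / 2 is the diameter of the cells. *)
pose N := (Num.truncn (2 * B * #|I|%:R / e)).+1.
have N0 : 0 < N%:R :> R by rewrite ltr0n.
have NP : B * (#|I|%:R / N%:R) <= e / 2.
  have h0 : 0 <= 2 * B * #|I|%:R / e by rewrite divr_ge0 ?(ltW e0)// mulr_ge0// mulr_ge0// ltW.
  have /andP[_] := truncn_itv h0; rewrite -/N ltr_pdivrMr// => h.
  rewrite mulrA ler_pdivrMr//; lra.
pose a rho i : R := fine (rho (c @^-1` [set i])).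
have a0 rho i : 0 <= a rho i * N%:R by rewrite mulr_ge0// fine_ge0.
have aN rho i : (Num.truncn (a rho i * N%:R) < N.+1)%N.
  rewrite ltnS -[leqRHS](natrK (R := R)) le_truncn// ler_piMl//.
  rewrite -(fiber_mass_sum1 rho mc) (bigD1 i)//= lerDl sumr_ge0// => j _.
  exact: fine_ge0.
exists {ffun I -> 'I_N.+1}, (fun rho => [ffun i => inord (Num.truncn (a rho i * N%:R))]).
move=> rho rho' /ffunP rr'.
have {}rr' i : Num.truncn (a rho i * N%:R) = Num.truncn (a rho' i * N%:R).
  by have := rr' i; rewrite !ffunE => /(congr1 val); rewrite /= !inordK.
pose m i : R := (Num.truncn (a rho i * N%:R))%:R / N%:R.
apply: (le_trans (@transport_fibers_le _ _ (@sdist R dx dy X Y) rho rho' _ c B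
  (e / 2) m _ _ _ _ _ _ _)) => //.
- exact: ltW.
- by move=> i; rewrite /m divr_ge0.
- by move=> i; rewrite /m ler_pdivrMr//; have /andP[] := truncn_itv (a0 rho i).
- by move=> i; rewrite /m rr' ler_pdivrMr//; have /andP[] := truncn_itv (a0 rho' i).
have : 1 - \sum_i m i <= #|I|%:R / N%:R.
  have a1 : \sum_i a rho i = 1 := fiber_mass_sum1 rho mc.
  apply: (@le_trans _ _ (\sum_(i : I) N%:R^-1)); last by rewrite sumr_const mulr_natl.
  rewrite lerBlDr -[leLHS]a1 -big_split/=; apply: ler_sum => i _.
  have /andP[_] := truncn_itv (a0 rho i).
  by rewrite -natr1 -ltr_pdivlMr// mulrDl mul1r addrC => /ltW.
move=> h; rewrite lee_fin.
have := ler_wpM2l (ltW B0) h; lra.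
Qed.

End WassersteinTasks.

(** * Measurable and real-valued risks *)

Section Risks.
Context (R : realType) (dx dy : nat) (X : compactSet R dx) (Y : compactSet R dy).
Variables (l : Y -> Y -> R) (Ll Lf : R).
Hypotheses (Ll0 : 0 <= Ll) (Lf0 : 0 <= Lf) (lL : loss_lipschitz Ll l).
Local Notation Z := (samples X Y).
Implicit Types (f : predictor X Y) (rho : task X Y) (PP : meta X Y).

Lemma loss_bounded : exists2 M : R, 0 <= M & forall y v, `|l y v| <= M.
Proof.
have [B YB] := edist_bounded Y; pose y0 : points Y := point.
have B0 : 0 <= B by apply: le_trans (YB y0 y0); exact: edist_nonneg.
exists (`|l y0 y0| + Ll * (B + B)) => [|y v]; first by rewrite addr_ge0// mulr_ge0// addr_ge0.
have := lL y y0 v y0.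
have : Ll * (edist y y0 + edist v y0) <= Ll * (B + B) by rewrite ler_wpM2l// lerD.
have := ler_normD (l y v - l y0 y0) (l y0 y0); rewrite subrK; lra.
Qed.

(** The context rho is separate from the sample z, so that true tasks and full or partial empirical
    contexts are treated alike. *)
Definition sample_loss f rho (z : Z) : R := l z.2 (f (rho, z.1)).

Lemma sample_loss_le f rho rho' z z' :
  `|sample_loss f rho z - sample_loss f rho' z'| <=
    Ll * (edist z.2 z'.2 + edist (f (rho, z.1)) (f (rho', z'.1))).
Proof. exact: lL. Qed.

(** The loss is uniformly continuous in a pair of measurable points of Y, indexed by [bool]: the
    prediction at [true] and the label at [false]. *)
Lemma measurable_sample_loss f : measurable_fun setT
  (fun u : borel (task X Y) * borel Z => sample_loss f u.1 u.2).
Proof.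
have mfst : measurable_fun setT (fst : borel Z -> borel (points X)).
  by apply: continuous_borel => z; exact: cvg_fst.
have msnd : measurable_fun setT (snd : borel Z -> borel (points Y)).
  by apply: continuous_borel => z; exact: cvg_snd.
pose u (b : bool) (w : borel (task X Y) * borel Z) : borel (points Y) :=
  if b then f (w.1, w.2.1) else w.2.2.
apply: (@measurable_fun_uniform R (points Y) (@edist R dy Y) _ _ bool u
  (fun a => l (a false) (a true))).
- exact: edist_finely_partitioned.
- case=> /=; last exact: measurableT_comp.
  apply: (measurableT_comp (measurable_funPT f)).
  apply: measurable_fun_pair; first exact: measurable_fst.
  exact: (measurableT_comp mfst).
- move=> e e0; exists (e / (Ll * 2 + 1)).
    by rewrite divr_gt0// ltr_wpDl// mulr_ge0.
  have h0 : 0 < Ll * 2 + 1 by rewrite ltr_wpDl// mulr_ge0.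
  move=> a b ab; apply: le_trans (lL _ _ _ _) _.
  have := lerD (ab false) (ab true) => /(ler_wpM2l Ll0)/le_trans; apply.
  have := divfK (lt0r_neq0 h0) e; have : 0 < e / (Ll * 2 + 1) by rewrite divr_gt0.
  by move: (e / _) => q q0 <-; nra.
Qed.

Lemma measurable_sample_loss_task f rho :
  measurable_fun setT (sample_loss f rho : borel Z -> R).
Proof. exact: (@measurable_fun_pair2 _ _ _ (borel (task X Y)) (borel Z) R _ rho
  (measurable_sample_loss f)). Qed.

Definition task_risk f rho : R :=
  \int[(rho : probability (borel Z) R)]_z sample_loss f rho z.

Definition meta_risk f PP : R :=
  \int[(PP : probability (borel (task X Y)) R)]_rho task_risk f rho.

Section Bounded.
Variable M : R.
Hypothesis lM : forall y v, `|l y v| <= M.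

Lemma sample_loss_integrable f rho :
  (rho : probability (borel Z) R).-integrable setT (EFin \o sample_loss f rho).
Proof.
apply: (@bounded_integrable _ _ _ (rho : probability (borel Z) R) _ M) => //.
  exact: measurable_sample_loss_task.
by move=> z; exact: lM.
Qed.

Lemma task_risk_bounded f rho : `|task_risk f rho| <= M.
Proof.
apply: (@Rintegral_bounded _ _ _ (rho : probability (borel Z) R)).
  exact: measurable_sample_loss_task.
by move=> z; exact: lM.
Qed.

Lemma measurable_task_risk f : measurable_fun setT (task_risk f : borel (task X Y) -> R).
Proof.
apply: (@measurable_Rintegral_task _ _ _ _ _ (fun u => sample_loss f u.1 u.2) M).
  exact: measurable_sample_loss.
by move=> u; exact: lM.
Qed.

Lemma task_risk_integrable f PP :
  (PP : probability (borel (task X Y)) R).-integrable setT (EFin \o task_risk f).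
Proof.
apply: (@bounded_integrable _ _ _ (PP : probability (borel (task X Y)) R) _ M).
  exact: measurable_task_risk.
exact: task_risk_bounded.
Qed.

(** The loss is bounded, so both integrals are finite and survive the passage to real numbers. *)
Lemma riskE f PP : risk l PP f = (meta_risk f PP)%:E.
Proof.
rewrite /risk /meta_risk /Rintegral fineK; last first.
  by apply: integrable_fin_num => //; exact: task_risk_integrable.
apply: eq_integral => rho _; rewrite /task_risk /Rintegral fineK//.
by apply: integrable_fin_num => //; exact: sample_loss_integrable.
Qed.

Lemma meta_risk_bounded f PP : `|meta_risk f PP| <= M.
Proof.
apply: (@Rintegral_bounded _ _ _ (PP : probability (borel (task X Y)) R)).
  exact: measurable_task_risk.
exact: task_risk_bounded.
Qed.

Lemma task_risk_empirical f n (s : 'I_n.+1 -> Z) :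
  task_risk f (empirical_prob R s) =
    n.+1%:R^-1 * \sum_(i < n.+1) sample_loss f (empirical_prob R s) (s i).
Proof.
rewrite /task_risk /Rintegral.
rewrite (@integral_empirical R _ (borel Z) n s _ M)//.
  exact: measurable_sample_loss_task.
by move=> z; exact: lM.
Qed.

Lemma meta_risk_empirical f n (s : 'I_n.+1 -> task X Y) :
  meta_risk f (empirical_prob R s) =
    n.+1%:R^-1 * \sum_(i < n.+1) task_risk f (s i).
Proof.
rewrite /meta_risk /Rintegral.
rewrite (@integral_empirical R _ (borel (task X Y)) n s _ M)//.
  exact: measurable_task_risk.
exact: task_risk_bounded.
Qed.

End Bounded.

End Risks.

(** * Lipschitz risks and finite nets of predictors *)

Section LipschitzRisks.
Context (R : realType) (dx dy : nat) (X : compactSet R dx) (Y : compactSet R dy).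
Variables (l : Y -> Y -> R) (Ll Lf : R).
Hypotheses (Ll0 : 0 <= Ll) (Lf0 : 0 <= Lf) (lL : loss_lipschitz Ll l).
Local Notation Z := (samples X Y).
Implicit Types (f : predictor X Y) (rho : task X Y) (PP : meta X Y).

Lemma edist_predictor_le f rho rho' x x' (r : R) : predictor_lipschitz Lf f ->
  (W1 rho rho' <= r%:E)%E ->
  edist (f (rho, x)) (f (rho', x')) <= Lf * (r + edist x x').
Proof.
move=> /(_ rho rho' x x') fL rr; rewrite -lee_fin EFinM EFinD (le_trans fL)//.
by rewrite lee_wpmul2l ?lee_fin// leeD2r.
Qed.

Lemma sample_loss_lipschitz f rho rho' z z' (r : R) : predictor_lipschitz Lf f ->
  (W1 rho rho' <= r%:E)%E ->
  `|sample_loss l f rho z - sample_loss l f rho' z'| <=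
    Ll * (edist z.2 z'.2 + Lf * (r + edist z.1 z'.1)).
Proof.
move=> fL rr; apply: le_trans (sample_loss_le lL _ _ _ _ _) _.
by rewrite ler_wpM2l// lerD2l edist_predictor_le.
Qed.

Lemma Clf_ge0 : 0 <= Clf Ll Lf.
Proof. by rewrite mulr_ge0// addr_ge0// mulr_ge0 ?sqrtr_ge0// le_max ler01. Qed.

(** Two effects add up to [Clf]. The change of context costs Ll Lf W1 uniformly in the samples and
    enters as the additive constant; moving a sample along a coupling costs Ll sqrt 2 max(1, Lf)
    times its displacement. *)
Lemma task_risk_lipschitz f rho rho' : predictor_lipschitz Lf f ->
  ((`|task_risk l f rho - task_risk l f rho'|)%:E <= (Clf Ll Lf)%:E * W1 rho rho')%E.
Proof.
move=> fL; have [M _ lM] := loss_bounded Ll0 lL.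
have Wfin := W1_fin_num rho rho'; set w := fine (W1 rho rho').
have Ww : W1 rho rho' = w%:E by rewrite fineK.
have -> : ((Clf Ll Lf)%:E * W1 rho rho' =
    (Ll * Lf * w)%:E + (Ll * (Num.sqrt 2 * Num.max 1 Lf))%:E * W1 rho rho')%E.
  by rewrite Ww -!EFinM -EFinD /Clf; congr (_%:E); ring.
apply: (@transport_difference _ _ _ _ M) => //.
- exact: (measurable_sample_loss_task Ll0 lL).
- by move=> z; exact: lM.
- exact: (measurable_sample_loss_task Ll0 lL).
- by move=> z; exact: lM.
- by rewrite mulr_ge0// mulr_ge0 ?sqrtr_ge0// le_max ler01.
- by move=> z z'; rewrite lee_fin sdist_ge0.
move=> z z'; rewrite -EFinM -EFinD lee_fin.
apply: le_trans (sample_loss_lipschitz z z' fL (_ : (_ <= w%:E)%E)) _; first by rewrite Ww.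
have d1 := edist_nonneg z.1 z'.1; have d2 := edist_nonneg z.2 z'.2.
have h1 : edist z.2 z'.2 <= Num.max 1 Lf * edist z.2 z'.2 by rewrite ler_peMl// le_max lexx.
have h2 : Lf * edist z.1 z'.1 <= Num.max 1 Lf * edist z.1 z'.1.
  by rewrite ler_wpM2r// le_max lexx orbT.
have h3 : Num.max 1 Lf * (edist z.1 z'.1 + edist z.2 z'.2) <=
    Num.max 1 Lf * (Num.sqrt 2 * sdist z z').
  by rewrite ler_wpM2l ?edistD_le// le_max ler01.
have -> : Ll * Lf * w + Ll * (Num.sqrt 2 * Num.max 1 Lf) * sdist z z' =
    Ll * (Lf * w + Num.max 1 Lf * (Num.sqrt 2 * sdist z z')) by ring.
by rewrite ler_wpM2l//; lra.
Qed.

Lemma meta_risk_lipschitz f PP QQ : predictor_lipschitz Lf f ->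
  ((`|meta_risk l f PP - meta_risk l f QQ|)%:E <= (Clf Ll Lf)%:E * metaW1 PP QQ)%E.
Proof.
move=> fL; have [M _ lM] := loss_bounded Ll0 lL.
rewrite -[leRHS]add0e; apply: (@transport_difference _ _ _ _ M).
- exact: (measurable_task_risk Ll0 lL lM).
- exact: (task_risk_bounded Ll0 lL lM).
- exact: (measurable_task_risk Ll0 lL lM).
- exact: (task_risk_bounded Ll0 lL lM).
- exact: Clf_ge0.
- exact: W1_ge0.
- by move=> rho rho'; rewrite add0e; exact: task_risk_lipschitz.
Qed.

(** In the manner of Arzela and Ascoli, a predictor is classified by the cells of its values at one
    representative of each cell of contexts and inputs. Two predictors of one class are close
    everywhere, by passing through the representatives. *)
Lemma predictor_net (F : set (predictor X Y)) (e : R) :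
  (forall f, F f -> predictor_lipschitz Lf f) -> 0 < e ->
  exists s : seq (predictor X Y), (forall g, List.In g s -> F g) /\
    forall f, F f -> exists2 g, List.In g s &
      forall rho z, `|sample_loss l f rho z - sample_loss l g rho z| <= e.
Proof.
move=> FL e0.
(* Two moves to a representative, at 2 Ll Lf r each, and one comparison of values, at Ll r, make Ll
   (4 Lf + 1) r; the last 1 avoids a zero denominator. *)
pose r := e / (Ll * (4 * Lf + 1) + 1).
have k0 : 0 < Ll * (4 * Lf + 1) + 1 by rewrite ltr_wpDl// mulr_ge0// addr_ge0// mulr_ge0.
have r0 : 0 < r by rewrite divr_gt0.
have [Kt [ct Pt]] := W1_totally_bounded X Y r0.
have [Kx [cx [_ Px]]] := edist_finely_partitioned X r0.
have [Ky [cy [_ Py]]] := edist_finely_partitioned Y r0.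
pose reptask k : task X Y := xget point (ct @^-1` [set k]).
have reptaskP rho : ct (reptask (ct rho)) = ct rho.
  by rewrite /reptask; case: xgetP => [y _ //|/(_ rho) /=].
pose reppt k : points X := xget point (cx @^-1` [set k]).
have repptP x : cx (reppt (cx x)) = cx x.
  by rewrite /reppt; case: xgetP => [y _ //|/(_ x) /=].
pose cl f : {ffun Kt * Kx -> Ky} := [ffun k => cy (f (reptask k.1, reppt k.2))].
have [s [sF scl]] := finite_representatives F cl.
exists s; split=> // f Ff; have [g sg /ffunP fg] := scl f Ff; exists g => // rho z.
set rho0 := reptask (ct rho); set z0 : Z := (reppt (cx z.1), z.2).
have near h : F h -> `|sample_loss l h rho z - sample_loss l h rho0 z0| <= Ll * (Lf * (r + r)).
  move=> Fh; apply: le_trans (sample_loss_lipschitz z z0 (FL h Fh) (_ : (_ <= r%:E)%E)) _.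
    by apply: Pt; rewrite reptaskP.
  rewrite ler_wpM2l// edistxx add0r ler_wpM2l// lerD2l.
  by apply: Px; rewrite repptP.
have mid : `|sample_loss l f rho0 z0 - sample_loss l g rho0 z0| <= Ll * r.
  apply: le_trans (lL _ _ _ _) _; rewrite edistxx add0r ler_wpM2l//; apply: Py.
  by have := fg (ct rho, cx z.1); rewrite !ffunE.
have nf := near f Ff; have := near g (sF g sg); rewrite distrC => ng.
have re : Ll * (Lf * (r + r)) + Ll * r + Ll * (Lf * (r + r)) <= e.
  have : r * (Ll * (4 * Lf + 1) + 1) = e by rewrite /r divfK// lt0r_neq0.
  by move=> <-; have := ltW r0; lra.
apply: le_trans re.
have -> : sample_loss l f rho z - sample_loss l g rho z =
    (sample_loss l f rho z - sample_loss l f rho0 z0) +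
    (sample_loss l f rho0 z0 - sample_loss l g rho0 z0) +
    (sample_loss l g rho0 z0 - sample_loss l g rho z) by ring.
rewrite (le_trans (ler_normD _ _))// lerD// (le_trans (ler_normD _ _))// lerD//.
Qed.

Lemma task_risk_close f g rho (e : R) :
  (forall z, `|sample_loss l f rho z - sample_loss l g rho z| <= e) ->
  `|task_risk l f rho - task_risk l g rho| <= e.
Proof.
move=> fg; have [M _ lM] := loss_bounded Ll0 lL.
apply: (@Rintegral_dist _ _ _ (rho : probability (borel Z) R) _ _ M) => //.
- exact: (measurable_sample_loss_task Ll0 lL).
- by move=> z; exact: lM.
- exact: (measurable_sample_loss_task Ll0 lL).
- by move=> z; exact: lM.
Qed.

Lemma meta_risk_close f g PP (e : R) :
  (forall rho z, `|sample_loss l f rho z - sample_loss l g rho z| <= e) ->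
  `|meta_risk l f PP - meta_risk l g PP| <= e.
Proof.
move=> fg; have [M _ lM] := loss_bounded Ll0 lL.
apply: (@Rintegral_dist _ _ _ (PP : probability (borel (task X Y)) R) _ _ M) => //.
- exact: (measurable_task_risk Ll0 lL lM).
- exact: (task_risk_bounded Ll0 lL lM).
- exact: (measurable_task_risk Ll0 lL lM).
- exact: (task_risk_bounded Ll0 lL lM).
- by move=> rho; exact: task_risk_close.
Qed.

(** Moving every sample by at most r moves the empirical context by at most r in [W1], so the loss
    is a uniformly continuous function of finitely many samples. *)
Lemma measurable_empirical_loss f d (W : measurableType d) (J : finType)
    (u : J -> W -> borel Z) k (s : 'I_k.+1 -> J) (j : J) :
  predictor_lipschitz Lf f -> (forall j, measurable_fun setT (u j)) ->
  measurable_fun setT (fun w =>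
    sample_loss l f (empirical_prob R (fun i => u (s i) w : Z)) (u j w)).
Proof.
move=> fL mu.
apply: (@measurable_fun_uniform R Z (@sdist R dx dy X Y) _ _ J u
  (fun a => sample_loss l f (empirical_prob R (fun i => a (s i))) (a j))) => //.
  exact: sdist_finely_partitioned.
move=> e e0; have k0 : 0 < Ll * (1 + 2 * Lf) + 1.
  by rewrite ltr_wpDl// mulr_ge0// addr_ge0// mulr_ge0.
exists (e / (Ll * (1 + 2 * Lf) + 1)); first by rewrite divr_gt0.
have : e / (Ll * (1 + 2 * Lf) + 1) * (Ll * (1 + 2 * Lf) + 1) = e by rewrite divfK// lt0r_neq0.
have : 0 < e / (Ll * (1 + 2 * Lf) + 1) by rewrite divr_gt0.
move: (e / _) => r r0 <- a b ab.
apply: le_trans (sample_loss_lipschitz _ _ fL (_ : (_ <= r%:E)%E)) _.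
  apply: transport_empirical_le => [z z'|i]; first by rewrite lee_fin sdist_ge0.
  by rewrite lee_fin.
have h1 := le_trans (edist_fst_le (a j) (b j)) (ab j).
have h2 := le_trans (edist_snd_le (a j) (b j)) (ab j).
have h3 : Lf * (r + edist (a j).1 (b j).1) <= Lf * (r + r) by rewrite ler_wpM2l// lerD2l.
have : Ll * (edist (a j).2 (b j).2 + Lf * (r + edist (a j).1 (b j).1)) <= Ll * (r + Lf * (r + r)).
  by rewrite ler_wpM2l// lerD.
by move/le_trans; apply; have := ltW r0; lra.
Qed.

End LipschitzRisks.

(** * Excess risk *)

Lemma dist_perturb (R : realDomainType) (a b a' b' e : R) :
  `|a - a'| <= e -> `|b - b'| <= e -> `|a - b| <= `|a' - b'| + (e + e).
Proof.
move=> aa bb; have -> : a - b = (a' - b') + ((a - a') - (b - b')) by ring.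
by rewrite (le_trans (ler_normD _ _))// lerD2l (le_trans (ler_normB _ _))// lerD.
Qed.

Section EmpiricalExcess.
Context (R : realType) (dx dy : nat) (X : compactSet R dx) (Y : compactSet R dy).
Variables (l : Y -> Y -> R) (Ll Lf : R) (F : set (predictor X Y)) (PP : meta X Y).
Variables (m n : nat) (d : measure_display) (Omega : measurableType d).
Variables (Pr : probability Omega R)
  (rho : 'I_m.+1 -> {RV Pr >-> borel (task X Y)})
  (z : 'I_m.+1 -> 'I_n.+2 -> {RV Pr >-> borel (samples X Y)})
  (fs : predictor X Y).
Hypotheses (Ll0 : 0 <= Ll) (Lf0 : 0 <= Lf) (lL : loss_lipschitz Ll l)
  (FL : forall f, F f -> predictor_lipschitz Lf f)
  (Ffs : F fs).

(* The masked and the autoregressive objectives both sum, over [k.+1] terms per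
   task, the loss at the sample [target j] in the context formed by the samples
   [context j i]. *)
Variables (k : nat) (target : 'I_k.+1 -> 'I_n.+2)
  (len : 'I_k.+1 -> nat) (context : forall j, 'I_(len j).+1 -> 'I_n.+2).

Let all_tasks w : meta X Y := empirical_prob R (fun t => rho t w : task X Y).
Let all_samples t w : task X Y := emp_all (fun j => z t j w).
Let all_pairs w : meta X Y := empirical_prob R (fun t => all_samples t w).
Let partial t (j : 'I_k.+1) w : task X Y :=
  empirical_prob R (fun i => z t (@context j i) w : samples X Y).

Let emp_risk (f : predictor X Y) w : R := (m.+1%:R * k.+1%:R)^-1 *
  \sum_(t < m.+1) \sum_(j < k.+1) sample_loss l f (partial t j w) (z t (target j) w).

(** The intermediate objective: the targets of [emp_risk], each in the full context of its task. *)
Let full_risk (f : predictor X Y) w : R := (m.+1%:R * k.+1%:R)^-1 *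
  \sum_(t < m.+1) \sum_(j < k.+1) sample_loss l f (all_samples t w) (z t (target j) w).

(** The risk is compared with [emp_risk] in four steps: true tasks, then sampled tasks, then their
    empirical measures, then [full_risk], then partial contexts. The third step costs kappa, the
    others are the deviations D. *)
Lemma empirical_excess (kappa : R) (fh : Omega -> predictor X Y) :
  (forall f w, F f -> `|meta_risk l f (all_pairs w) - full_risk f w| <= kappa) ->
  (forall w, F (fh w) /\ forall g, F g -> emp_risk (fh w) w <= emp_risk g w) ->
  (\int[Pr]_w risk l PP (fh w) - risk l PP fs <=
     (2 * Clf Ll Lf)%:E * \int[Pr]_w metaW1 PP (all_tasks w)
     + (2 * Clf Ll Lf)%:E * \int[Pr]_w metaW1 (all_tasks w) (all_pairs w)
     + (2 * Ll * Lf / (m.+1%:R * k.+1%:R))%:E *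
         \sum_(t < m.+1) \sum_(j < k.+1) \int[Pr]_w W1 (all_samples t w) (partial t j w)
     + (2 * kappa)%:E)%E.
Proof.
move=> gap fh_min.
have [M M0 lM] := loss_bounded Ll0 lL.
pose q : R := (m.+1%:R * k.+1%:R)^-1.
have q0 : 0 <= q by rewrite invr_ge0 mulr_ge0.
have q1 : q <= 1 by rewrite invf_le1 -?natrM ?ler1n ?ltr0n muln_gt0.
(* Each pair (t, j) is an index of its own: the final sum stands outside the integrals, and an
   integral of a sum of functions not known to be measurable could not be split later. *)
pose K := (bool + 'I_m.+1 * 'I_k.+1)%type.
pose D (x : K) (f : predictor X Y) w : R := match x with
  | inl true => `|meta_risk l f PP - meta_risk l f (all_tasks w)|
  | inl false => `|meta_risk l f (all_tasks w) - meta_risk l f (all_pairs w)|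
  | inr (t, j) => q * `|sample_loss l f (all_samples t w) (z t (target j) w) -
                        sample_loss l f (partial t j w) (z t (target j) w)|
  end.
pose H (x : K) w : \bar R := match x with
  | inl true => metaW1 PP (all_tasks w)
  | inl false => metaW1 (all_tasks w) (all_pairs w)
  | inr (t, j) => W1 (all_samples t w) (partial t j w)
  end.
pose c (x : K) : R := if x is inl _ then Clf Ll Lf else q * (Ll * Lf).
have mz t j : measurable_fun setT (z t j : Omega -> borel (samples X Y)).
  exact: measurable_funPT.
have mloss t f p (s : 'I_p.+1 -> 'I_n.+2) j : F f -> measurable_fun setT (fun w =>
    sample_loss l f (empirical_prob R (fun i => z t (s i) w : samples X Y)) (z t j w)).
  move=> Ff; apply: (measurable_empirical_loss
    (u := fun i => z t i : Omega -> borel (samples X Y)) Ll0 Lf0 lL s j (FL Ff)) => i.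
  exact: mz.
have mtasks f : measurable_fun setT (fun w => meta_risk l f (all_tasks w)).
  rewrite (_ : (fun w => _) = fun w => m.+1%:R^-1 * \sum_(t < m.+1) task_risk l f (rho t w)).
    apply: measurable_funM => //; apply: measurable_sum => t.
    apply: (measurableT_comp (measurable_task_risk Ll0 lL lM f)).
    exact: measurable_funPT.
  by apply/funext => w; rewrite (meta_risk_empirical Ll0 lL lM).
have mpairs f : F f -> measurable_fun setT (fun w => meta_risk l f (all_pairs w)).
  move=> Ff; rewrite (_ : (fun w => _) = fun w => m.+1%:R^-1 * \sum_(t < m.+1)
      n.+2%:R^-1 * \sum_(j < n.+2) sample_loss l f (all_samples t w) (z t j w)).
    apply: measurable_funM => //; apply: measurable_sum => t.
    apply: measurable_funM => //; apply: measurable_sum => j.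
    exact: (mloss t f n.+1 id j Ff).
  apply/funext => w; rewrite (meta_risk_empirical Ll0 lL lM); congr (_ * _).
  by apply: eq_bigr => t _; rewrite (task_risk_empirical Ll0 lL lM).
have -> : risk l PP fs = (meta_risk l fs PP)%:E by exact: (riskE Ll0 lL lM).
under eq_integral do rewrite (riskE Ll0 lL lM).
have := @expected_excess _ _ _ Pr _ F K (fun f => meta_risk l f PP) D c H (M + M)
  (2 * kappa) fs fh Ffs (fun w => (fh_min w).1) _ _ _ _ _ _ _.
have -> : (\sum_x (2 * c x)%:E * \int[Pr]_w H x w =
  (2 * Clf Ll Lf)%:E * \int[Pr]_w metaW1 PP (all_tasks w)
     + (2 * Clf Ll Lf)%:E * \int[Pr]_w metaW1 (all_tasks w) (all_pairs w)
     + (2 * Ll * Lf / (m.+1%:R * k.+1%:R))%:E *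
         \sum_(t < m.+1) \sum_(j < k.+1) \int[Pr]_w W1 (all_samples t w) (partial t j w))%E.
  rewrite big_sumType/= big_bool/=; congr (_ + _)%E.
  rewrite ge0_sume_distrr; last first.
    by move=> t _; apply: sume_ge0 => j _; apply: integral_ge0 => w _; exact: W1_ge0.
  under [RHS]eq_bigr => t _.
    rewrite ge0_sume_distrr; last first.
      by move=> j _; apply: integral_ge0 => w _; exact: W1_ge0.
    over.
  rewrite pair_bigA/=; apply: eq_bigr => -[t j] _ /=; congr (_%:E * _)%E.
  by rewrite -/q; ring.
apply.
- by case=> [b|p]; rewrite /c; [exact: Clf_ge0|rewrite mulr_ge0// mulr_ge0].
- by case=> [[]|[t j]] w /=; [apply: transport_ge0 => *; exact: W1_ge0..|exact: W1_ge0].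
- case=> [[]|[t j]] f Ff /=.
  + by apply: measurableT_comp => //; exact: measurable_funB.
  + by apply: measurableT_comp => //; apply: measurable_funB => //; exact: mpairs.
  + apply: measurable_funM => //; apply: measurableT_comp => //; apply: measurable_funB.
      exact: (mloss t f n.+1 id (target j) Ff).
    exact: (mloss t f (len j) (@context j) (target j) Ff).
- have dM a b : `|a| <= M -> `|b| <= M -> 0 <= `|a - b| <= M + M.
    by move=> aM bM; rewrite normr_ge0 (le_trans (ler_normB _ _))// lerD.
  have mM QQ f := meta_risk_bounded Ll0 lL lM f QQ.
  case=> [[]|[t j]] f w Ff /=; [exact: dM..|].
  have /andP[h1 h2] : 0 <= `|sample_loss l f (all_samples t w) (z t (target j) w) -
      sample_loss l f (partial t j w) (z t (target j) w)| <= M + M by exact: dM (lM _ _) (lM _ _).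
  by rewrite mulr_ge0//= (le_trans _ h2)// ler_piMl.
- case=> [[]|[t j]] f w Ff /=.
  + exact: (meta_risk_lipschitz Ll0 Lf0 lL _ _ (FL Ff)).
  + exact: (meta_risk_lipschitz Ll0 Lf0 lL _ _ (FL Ff)).
  + have Wfin := W1_fin_num (all_samples t w) (partial t j w).
    rewrite -(fineK Wfin) -EFinM lee_fin -mulrA ler_wpM2l//.
    have := sample_loss_lipschitz Ll0 Lf0 lL (z t (target j) w) (z t (target j) w) (FL Ff)
      (_ : (W1 (all_samples t w) (partial t j w) <=
        (fine (W1 (all_samples t w) (partial t j w)))%:E)%E).
    by rewrite !edistxx add0r addr0 mulrA; apply; rewrite fineK.
(* The mesh is e / 2 because a deviation compares two quantities, each of which moves by at most the
   mesh. *)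
- move=> e e0; have [|s [sF snet]] := predictor_net Ll0 Lf0 lL FL (_ : 0 < e / 2).
    by rewrite divr_gt0.
  exists s; split=> // f Ff; have [g sg fg] := snet f Ff; exists g => // x w.
  have fgm QQ : `|meta_risk l f QQ - meta_risk l g QQ| <= e / 2.
    exact: (meta_risk_close Ll0 lL).
  have ee : e / 2 + e / 2 = e by rewrite -splitr.
  case: x => [[]|[t j]] /=; rewrite -{1}ee; [exact: dist_perturb..|].
  apply: le_trans (ler_wpM2l q0 (dist_perturb (fg _ _) (fg _ _))) _.
  by rewrite mulrDr lerD2l ee ler_piMl// ltW.
- move=> w; have [Ff fmin] := fh_min w.
  have step f : F f -> `|meta_risk l f PP - emp_risk f w| <= \sum_x D x f w + kappa.
    move=> Ff'; rewrite big_sumType/= big_bool/= -/(all_tasks w).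
    have : `|full_risk f w - emp_risk f w| <= \sum_(p : 'I_m.+1 * 'I_k.+1) D (inr p) f w.
      have -> : \sum_(p : 'I_m.+1 * 'I_k.+1) D (inr p) f w =
          \sum_(t < m.+1) \sum_(j < k.+1) D (inr (t, j)) f w.
        by rewrite pair_bigA/=; apply: eq_bigr => -[].
      rewrite /full_risk /emp_risk -mulrBr normrM ger0_norm// -sumrB.
      rewrite (le_trans (ler_wpM2l q0 (ler_norm_sum _ _ _)))//.
      rewrite mulr_sumr; apply: ler_sum => t _.
      rewrite -sumrB (le_trans (ler_wpM2l q0 (ler_norm_sum _ _ _)))// mulr_sumr.
      exact: ler_sum.
    have := gap f w Ff'.
    have -> : meta_risk l f PP - emp_risk f w =
      (meta_risk l f PP - meta_risk l f (all_tasks w)) +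
      (meta_risk l f (all_tasks w) - meta_risk l f (all_pairs w)) +
      ((meta_risk l f (all_pairs w) - full_risk f w) + (full_risk f w - emp_risk f w)) by ring.
    move=> h1 h2.
    apply: le_trans (ler_normD _ _) _.
    apply: le_trans (lerD (ler_normD _ _) (le_trans (ler_normD _ _) (lerD h1 h2))) _.
    by rewrite [kappa + _]addrC addrA.
  (* One bound for the learned predictor and one for [fs], linked by minimality; hence the factor 2
     on kappa. *)
  have /ler_normlP[_ s1] := step _ Ff; have /ler_normlP[s2 _] := step _ Ffs.
  have := fmin _ Ffs; rewrite big_split/=.
  move: (\sum_x _) (\sum_x _) s1 s2 => S1 S2; lra.
Qed.

End EmpiricalExcess.

(** * The masked and the autoregressive bounds *)

Local Open Scope classical_set_scope.
Local Open Scope ereal_scope.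

Lemma loss_bound_fin (R : realType) dy (Y : compactSet R dy) (l : Y -> Y -> R) (Ll : R) :
  (0 <= Ll)%R -> loss_lipschitz Ll l ->
  exists M : R, [/\ (0 <= M)%R, forall y v, (`|l y v| <= M)%R & loss_bound l = M%:E].
Proof.
move=> Ll0 lL; have [M _ lM] := loss_bounded Ll0 lL.
have lb y v : (`|l y v|%R)%:E <= loss_bound l by apply: ereal_sup_ubound; exists (y, v).
have lb0 : 0 <= loss_bound l.
  by apply: le_trans (lb (point : points Y) (point : points Y)); rewrite lee_fin.
have lbM : loss_bound l <= M%:E.
  by apply: ge_ereal_sup => _ [[y v] _ <-]; rewrite lee_fin.
have lfin : loss_bound l \is a fin_num.
  by rewrite ge0_fin_numE// (le_lt_trans lbM)// ltry.
exists (fine (loss_bound l)); split; [exact: fine_ge0| |by rewrite fineK].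
by move=> y v; rewrite -lee_fin fineK.
Qed.

(** The difference of the two means is the first term minus the mean of the others, divided by n +
    2. *)
Lemma drop_first_mean (R : realFieldType) (n : nat) (a : 'I_n.+2 -> R) (M : R) :
  (forall i, `|a i| <= M)%R ->
  (`|n.+2%:R^-1 * \sum_i a i - n.+1%:R^-1 * \sum_(k < n.+1) a (lift ord0 k)| <=
    2 * M / n.+2%:R)%R.
Proof.
move=> aM; rewrite big_ord_recl/=; set S := (\sum_(i < n.+1) _)%R.
have SM : (`|S| <= n.+1%:R * M)%R.
  rewrite (le_trans (ler_norm_sum _ _ _))// mulr_natl -[n.+1 in leRHS]card_ord -sumr_const.
  by apply: ler_sum => i _; exact: aM.
have n2 : (n.+2%:R = n.+1%:R + 1 :> R)%R by rewrite -natr1.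
have -> : (n.+2%:R^-1 * (a ord0 + S) - n.+1%:R^-1 * S =
    (a ord0 - S / n.+1%:R) / n.+2%:R)%R.
  have : (0 < n.+1%:R :> R)%R by rewrite ltr0n.
  by rewrite n2; move: n.+1%:R => p p0; field; rewrite !gt_eqF ?addr_gt0.
rewrite normrM [X in (_ * X)%R]ger0_norm ?invr_ge0// ler_wpM2r ?invr_ge0//.
rewrite (le_trans (ler_normB _ _))// mulr_natl mulr2n lerD// normrM.
by rewrite [X in (_ * X)%R]ger0_norm ?invr_ge0// ler_pdivrMr// mulrC.
Qed.

Theorem theorem6 (R : realType) (dx dy : nat)
    (X : compactSet R dx) (Y : compactSet R dy)
    (l : Y -> Y -> R) (Ll Lf : R) (F : set (predictor X Y))
    (PP : meta X Y) (m n : nat)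
    (d : measure_display) (Omega : measurableType d) (Pr : probability Omega R)
    (rho : 'I_m.+1 -> {RV Pr >-> borel (task X Y)})
    (z : 'I_m.+1 -> 'I_n.+2 -> {RV Pr >-> borel (samples X Y)})
    (fstar : predictor X Y) :
  (0 <= Ll)%R -> (0 <= Lf)%R ->
  loss_lipschitz Ll l ->
  (forall f, F f -> predictor_lipschitz Lf f) ->
  training_data PP rho z ->
  argmin_on (risk l PP) F fstar ->
  let C := Clf Ll Lf in
  let PP_T w : meta X Y := empirical_prob R (fun t => rho t w : task X Y) in
  let PP_TN w : meta X Y :=
    empirical_prob R (fun t => emp_all (fun j => z t j w)) in
  (forall fhat : Omega -> predictor X Y,
    (forall w, argmin_on (fun f => (masked_risk l (fun t j => z t j w) f)%:E) F
                 (fhat w)) ->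
    \int[Pr]_w risk l PP (fhat w) - risk l PP fstar
      <= (2 * C)%:E * \int[Pr]_w metaW1 PP (PP_T w)
       + (2 * C)%:E * \int[Pr]_w metaW1 (PP_T w) (PP_TN w)
       + (2 * Ll * Lf / (m.+1%:R * n.+2%:R))%:E *
           \sum_(t < m.+1) \sum_(j < n.+2)
             \int[Pr]_w W1 (emp_all (fun i => z t i w))
                           (emp_others (fun i => z t i w) j))
  /\
  (forall fbar : Omega -> predictor X Y,
    (forall w, argmin_on
                 (fun f => (autoregressive_risk l (fun t j => z t j w) f)%:E) F
                 (fbar w)) ->
    \int[Pr]_w risk l PP (fbar w) - risk l PP fstar
      <= (2 * C)%:E * \int[Pr]_w metaW1 PP (PP_T w)
       + (2 * C)%:E * \int[Pr]_w metaW1 (PP_T w) (PP_TN w)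
       + (2 * Ll * Lf / (m.+1%:R * n.+1%:R))%:E *
           \sum_(t < m.+1) \sum_(k < n.+1)
             \int[Pr]_w W1 (emp_all (fun i => z t i w))
                           (emp_before (fun i => z t i w) k)
       + (4 / n.+2%:R)%:E * loss_bound l).
Proof.
move=> Ll0 Lf0 lL FL _ fs_min C PP_T PP_TN.
have [M [M0 lM lbM]] := loss_bound_fin Ll0 lL.
pose all_loss f w t j := sample_loss l f (emp_all (fun i => z t i w)) (z t j w).
have pairsE f w : meta_risk l f (PP_TN w) =
    (m.+1%:R^-1 * \sum_(t < m.+1) (n.+2%:R^-1 * \sum_(j < n.+2) all_loss f w t j))%R.
  rewrite (meta_risk_empirical Ll0 lL lM); congr (_ * _)%R.
  by apply: eq_bigr => t _; rewrite (task_risk_empirical Ll0 lL lM).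
split=> [fhat fhat_min|fbar fbar_min].
  (* Every sample is a target and [lift j] enumerates the others. The average over all samples in
     their full contexts is the risk at [PP_TN], so the gap is 0. *)
  have := @empirical_excess R dx dy X Y l Ll Lf F PP m n d Omega Pr rho z fstar Ll0 Lf0 lL FL
    fs_min.1 n.+1 id (fun=> n) (fun j i => lift j i) 0%R fhat.
  rewrite mulr0 adde0; apply.
    move=> f w _; rewrite pairsE -mulr_sumr mulrA -invfM [X in (`|X|)%R]subrr normr0//.
  exact: fhat_min.
(* The first sample is no target. With N = n + 2, its omission moves a mean by at most 2 M / N,
   which the excess bound doubles to 4 M / N. *)
have := @empirical_excess R dx dy X Y l Ll Lf F PP m n d Omega Pr rho z fstar Ll0 Lf0 lL FL
  fs_min.1 n (lift ord0) (fun k => k)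
  (fun k i => widen_ord (leqW (ltn_ord k)) i) (2 * M / n.+2%:R)%R fbar.
rewrite lbM -EFinM (_ : (4 / n.+2%:R * M = 2 * (2 * M / n.+2%:R))%R); last by ring.
apply.
  move=> f w _; rewrite pairsE invfM -[(_ * _ * \sum_(t < m.+1) _)%R]mulrA -mulrBr mulr_sumr -sumrB.
  rewrite normrM [X in (X * _)%R]ger0_norm ?invr_ge0// ler_pdivrMl//.
  rewrite (le_trans (ler_norm_sum _ _ _))//.
  apply: (@le_trans _ _ (\sum_(t < m.+1) (2 * M / n.+2%:R)))%R; last first.
    by rewrite sumr_const card_ord -[(_ *+ m.+1)%R]mulr_natl.
  apply: ler_sum => t _.
  by apply: (@drop_first_mean _ _ (all_loss f w t)) => i; exact: lM.
exact: fbar_min.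
Qed.
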